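(* Consider three falling balls with masses satisfying $m_1>m_2\ge m_3>0$ and $2\sqrt{m_1}\sqrt{m_3}=\sqrt{m_1+m_2}\,\sqrt{m_2+m_3}$, on a fixed energy level $c>0$. For $\mu_{|_{\mathcal{S}^{-}}}$-a.e. $x\in\mathcal{S}^{-}$, $$\lim_{n\to+\infty}Q\bigl(d_xT^{n}(\delta\xi,\delta\eta)\bigr)=+\infty\quad\text{for all }(\delta\xi,\delta\eta)\in\overline{\mathcal{C}(x)}\setminus\{\vec 0\},$$ and for $\mu_{|_{\mathcal{S}^{+}}}$-a.e. $x\in\mathcal{S}^{+}$, $$\lim_{n\to+\infty}Q\bigl(d_xT^{-n}(\delta\xi,\delta\eta)\bigr)=-\infty\quad\text{for all }(\delta\xi,\delta\eta)\in\overline{\mathcal{C}'(x)}\setminus\{\vec 0\}.$$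
   Context: **System.** Three point particles (balls) with masses $m_1,m_2,m_3$, positions $0\le q_1\le q_2\le q_3$, momenta $p_i$ and velocities $v_i=p_i/m_i$ have Hamiltonian $H(q,p)=\sum_{i=1}^3\bigl(\frac{p_i^2}{2m_i}+m_iq_i\bigr)$. Between collisions $\dot q_i=p_i/m_i$, $\dot p_i=-m_i$; the flow is $\phi^t$ on $\{H=c\}\cap\{0\le q_1\le q_2\le q_3\}$. Collisions are elastic: at the floor ($q_1=0$), $v_1^+=-v_1^-$; when $q_i=q_{i+1}$ ($i=1,2$), $v_i^+=\gamma_iv_i^-+(1-\gamma_i)v_{i+1}^-$ and $v_{i+1}^+=(1+\gamma_i)v_i^--\gamma_iv_{i+1}^-$, with $\gamma_i=\frac{m_i-m_{i+1}}{m_i+m_{i+1}}$. Let $\Phi$ denote the collision map (position unchanged, velocities before $\mapsto$ velocities after). **Poincaré section and map.** On $\{H=c,\ 0\le q_1\le q_2\le q_3\}$ set $\mathcal{M}_1^+=\{q_1=0,\ v_1\ge 0\}$, $\mathcal{M}_i^+=\{q_{i-1}=q_i,\ v_{i-1}\le v_i\}$ for $i=2,3$, and $\mathcal{M}^+=\bigcup_i\mathcal{M}_i^+$ (states right after a collision). Analogously $\mathcal{M}_1^-=\{q_1=0,\ v_1<0\}$, $\mathcal{M}_i^-=\{q_{i-1}=q_i,\ v_{i-1}>v_i\}$, $\mathcal{M}^-=\bigcup_i\mathcal{M}_i^-$ (states right before a collision). With $\tau$ the first hitting time of $\mathcal{M}^-$, $T=\Phi\circ\phi^{\tau}:\mathcal{M}^+\to\mathcal{M}^+$.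 The Liouville volume, restricted to the energy level and contracted with the Hamiltonian vector field, gives a smooth $T$-invariant measure $\mu$ on $\mathcal{M}^+$. **Singularity manifolds (codimension one in $\mathcal{M}^+$).** $\mathcal{S}_{1,2}^+=\{x\in\mathcal{M}_1^+:\phi^{\tau(x)}x\in\mathcal{M}_2^-\cap\mathcal{M}_3^-\}$, $\mathcal{S}_{3,1}^+=\{x\in\mathcal{M}_3^+:\phi^{\tau(x)}x\in\mathcal{M}_1^-\cap\mathcal{M}_2^-\}$, $\mathcal{S}_{1,2}^-=\{x\in\mathcal{M}_2^+\cap\mathcal{M}_3^+:Tx\in\mathcal{M}_1^+\}$, $\mathcal{S}_{3,1}^-=\{x\in\mathcal{M}_1^+\cap\mathcal{M}_2^+:Tx\in\mathcal{M}_3^+\}$, and $\mathcal{S}^\pm=\mathcal{S}_{1,2}^\pm\cup\mathcal{S}_{3,1}^\pm$. $\mu_{|_{\mathcal{S}^\pm}}$ is the restriction of the smooth measure $\mu$ to $\mathcal{S}^\pm$ (the induced smooth measure on this codimension one manifold). On $\mathcal{S}^+$ the map $T$, and on $\mathcal{S}^-$ the map $T^{-1}$, has two images (the simultaneous collisions can be performed in either order); orbits meeting such a set are continued along both branches separately and statements are understood for each branch. **Tangent coordinates.** Put $h_i=\frac{p_i^2}{2m_i}+m_iq_i$, $\xi=A^{-1}h$, $\eta=A^{T}v$, where $A$ is the matrix with columns $\frac{1}{m_1+m_2+m_3}(m_1,m_2,m_3)^T$, $(1,-1,0)^T$, $(0,1,-1)^T$; then $\xi_1=H$ and the Hamiltonian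 field is $-\partial_{\eta_1}$. The tangent space of the energy level modulo the flow direction is identified with $L_1\oplus L_2$, where $L_1=\{(\delta\xi,0):\delta\xi_1=0\}$ and $L_2=\{(0,\delta\eta):\delta\eta_1=0\}$ in $\mathbb{R}^3\times\mathbb{R}^3$; thus on it $\delta\xi_2=\delta h_1$, $\delta\xi_3=\delta h_1+\delta h_2$, $\delta\eta_2=\delta v_1-\delta v_2$, $\delta\eta_3=\delta v_2-\delta v_3$. The derivative $d_xT$ is regarded as a linear map of $L_1\oplus L_2$. The flow acts as the identity, so $d_xT$ is the derivative of the collision that occurs: - floor: $\delta\eta_2\mapsto\delta\eta_2+\beta\,\delta\xi_2$, other coordinates unchanged, $\beta=-\frac{2}{m_1v_1^-}$; - balls 1,2: $\delta\xi_2\mapsto-\delta\xi_2+(1+\gamma_1)\delta\xi_3-\alpha_1\delta\eta_2$, $\delta\xi_3\mapsto\delta\xi_3$, $\delta\eta_2\mapsto-\delta\eta_2$, $\delta\eta_3\mapsto(1+\gamma_1)\delta\eta_2+\delta\eta_3$; - balls 2,3: $\delta\xi_2\mapsto\delta\xi_2$, $\delta\xi_3\mapsto(1-\gamma_2)\delta\xi_2-\delta\xi_3-\alpha_2\delta\eta_3$, $\delta\eta_2\mapsto\delta\eta_2+(1-\gamma_2)\delta\eta_3$, $\delta\eta_3\mapsto-\delta\eta_3$; here $\alpha_i=\frac{2m_im_{i+1}(m_i-m_{i+1})(v_i^--v_{i+1}^-)}{(m_i+m_{i+1})^2}$. $d_xT^{n}$ is the composition along the orbit and $d_xT^{-n}$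 is the derivative of $T^{-n}$. **Quadratic form and cones.** $Q(\delta\xi,\delta\eta)=\sum_{i=1}^3\delta\xi_i\delta\eta_i$; $\mathcal{C}(x)=\{w\in L_1\oplus L_2: Q(w)>0\}\cup\{\vec0\}$, $\mathcal{C}'(x)=\{w\in L_1\oplus L_2:Q(w)<0\}\cup\{\vec0\}$; bars denote closures. *)

(* Defs.v *)
From HB Require Import structures.
From mathcomp Require Import all_boot all_order all_algebra.
From mathcomp Require Import all_classical all_reals all_analysis.
From mathcomp Require Import ring.

Set Implicit Arguments.
Unset Strict Implicit.
Unset Printing Implicit Defensive.

Import Order.TTheory GRing.Theory Num.Theory.
Import numFieldNormedType.Exports.

Local Open Scope classical_set_scope.
Local Open Scope ring_scope.

Definition b1 : 'I_3 := @Ordinal 3 0 isT.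
Definition b2 : 'I_3 := @Ordinal 3 1 isT.
Definition b3 : 'I_3 := @Ordinal 3 2 isT.

Definition col3 (R : realType) (a b c : R) : 'cV[R]_3 :=
  \col_(i < 3) [:: a; b; c]`_i.

(* A state is the pair (q, p) of positions and momenta. *)
Definition phase (R : realType) : Type := ('cV[R]_3 * 'cV[R]_3)%type.

Definition pos (R : realType) (x : phase R) (i : 'I_3) : R := x.1 i ord0.
Definition mom (R : realType) (x : phase R) (i : 'I_3) : R := x.2 i ord0.
Definition vel (R : realType) (m : 'I_3 -> R) (x : phase R) (i : 'I_3) : R :=
  mom x i / m i.

Definition energy (R : realType) (m : 'I_3 -> R) (x : phase R) (i : 'I_3) : R :=
  mom x i ^+ 2 / (2 * m i) + m i * pos x i.

Definition H (R : realType) (m : 'I_3 -> R) (x : phase R) : R :=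
  \sum_(i < 3) energy m x i.

Definition Dom (R : realType) (m : 'I_3 -> R) (c : R) : set (phase R) :=
  [set x | H m x = c /\ [/\ 0 <= pos x b1, pos x b1 <= pos x b2
                          & pos x b2 <= pos x b3]].

(* The solution of q_i' = p_i / m_i, p_i' = - m_i. *)
Definition flow (R : realType) (m : 'I_3 -> R) (t : R) (x : phase R) : phase R :=
  (\col_(i < 3) (pos x i + vel m x i * t - t ^+ 2 / 2),
   \col_(i < 3) (mom x i - m i * t)).

(* The three collisions, in the order of the index i of M_i^+ and M_i^-:
   ball 1 with the floor, balls 1 and 2, balls 2 and 3. *)
Variant wall := Floor | Balls12 | Balls23.

Definition gamma (R : realType) (m : 'I_3 -> R) (i j : 'I_3) : R :=
  (m i - m j) / (m i + m j).

Definition Phi (R : realType) (m : 'I_3 -> R) (k : wall) (x : phase R) :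
    phase R :=
  let v := vel m x in
  (x.1,
   match k with
   | Floor => col3 (m b1 * - v b1) (mom x b2) (mom x b3)
   | Balls12 => let g := gamma m b1 b2 in
       col3 (m b1 * (g * v b1 + (1 - g) * v b2))
            (m b2 * ((1 + g) * v b1 - g * v b2)) (mom x b3)
   | Balls23 => let g := gamma m b2 b3 in
       col3 (mom x b1) (m b2 * (g * v b2 + (1 - g) * v b3))
            (m b3 * ((1 + g) * v b2 - g * v b3))
   end).

Definition Mp (R : realType) (m : 'I_3 -> R) (c : R) (k : wall) :
    set (phase R) :=
  Dom m c `&`
  match k with
  | Floor => [set x | pos x b1 = 0 /\ 0 <= vel m x b1]
  | Balls12 => [set x | pos x b1 = pos x b2 /\ vel m x b1 <= vel m x b2]
  | Balls23 => [set x | pos x b2 = pos x b3 /\ vel m x b2 <= vel m x b3]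
  end.

Definition Mm (R : realType) (m : 'I_3 -> R) (c : R) (k : wall) :
    set (phase R) :=
  Dom m c `&`
  match k with
  | Floor => [set x | pos x b1 = 0 /\ vel m x b1 < 0]
  | Balls12 => [set x | pos x b1 = pos x b2 /\ vel m x b1 > vel m x b2]
  | Balls23 => [set x | pos x b2 = pos x b3 /\ vel m x b2 > vel m x b3]
  end.

Definition Mplus (R : realType) (m : 'I_3 -> R) (c : R) : set (phase R) :=
  [set x | exists k, Mp m c k x].
Definition Mminus (R : realType) (m : 'I_3 -> R) (c : R) : set (phase R) :=
  [set x | exists k, Mm m c k x].

(* The hitting times of Mminus form a finite set, so that the infimum is
   attained as soon as there is one.  Otherwise tau m c x = 0, and [hit m c x]
   is not in Mminus.  Time 0 is allowed: after the first of several
   simultaneous collisions the next one takes place immediately. *)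
Definition tau (R : realType) (m : 'I_3 -> R) (c : R) (x : phase R) : R :=
  inf [set t | 0 <= t /\ Mminus m c (flow m t x)].

Definition hit (R : realType) (m : 'I_3 -> R) (c : R) (x : phase R) : phase R :=
  flow m (tau m c x) x.

(* [step m c k x y]: y is the image T x obtained by performing the collision k.
   This is a relation because T has several images when several collisions are
   due simultaneously, one for each collision that can be performed first. *)
Definition step (R : realType) (m : 'I_3 -> R) (c : R) (k : wall)
    (x y : phase R) : Prop :=
  [/\ Mplus m c x, Mm m c k (hit m c x) & y = Phi m k (hit m c x)].

Definition S12p (R : realType) (m : 'I_3 -> R) (c : R) : set (phase R) :=
  [set x | Mp m c Floor x /\ (Mm m c Balls12 `&` Mm m c Balls23) (hit m c x)].
Definition S31p (R : realType) (m : 'I_3 -> R) (c : R) : set (phase R) :=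
  [set x | Mp m c Balls23 x /\ (Mm m c Floor `&` Mm m c Balls12) (hit m c x)].
Definition S12m (R : realType) (m : 'I_3 -> R) (c : R) : set (phase R) :=
  [set x | (Mp m c Balls12 `&` Mp m c Balls23) x /\
           exists k y, step m c k x y /\ Mp m c Floor y].
Definition S31m (R : realType) (m : 'I_3 -> R) (c : R) : set (phase R) :=
  [set x | (Mp m c Floor `&` Mp m c Balls12) x /\
           exists k y, step m c k x y /\ Mp m c Balls23 y].

Definition Splus (R : realType) (m : 'I_3 -> R) (c : R) : set (phase R) :=
  S12p m c `|` S31p m c.
Definition Sminus (R : realType) (m : 'I_3 -> R) (c : R) : set (phase R) :=
  S12m m c `|` S31m m c.

Definition Amx (R : realType) (m : 'I_3 -> R) : 'M[R]_3 :=
  \matrix_(i < 3, j < 3)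
    [:: m i / (m b1 + m b2 + m b3);
        (col3 1 (-1) 0 : 'cV[R]_3) i ord0;
        (col3 0 1 (-1) : 'cV[R]_3) i ord0]`_j.

Definition xi (R : realType) (m : 'I_3 -> R) (x : phase R) : 'cV[R]_3 :=
  invmx (Amx m) *m \col_(i < 3) energy m x i.
Definition eta (R : realType) (m : 'I_3 -> R) (x : phase R) : 'cV[R]_3 :=
  (Amx m)^T *m \col_(i < 3) vel m x i.

(* The coordinates (xi_2, xi_3, eta_2, eta_3).  They are constant along the
   flow.  Since dq /\ dp = dh /\ dv = dxi /\ deta, with xi_1 = H and the
   Hamiltonian field equal to - d/deta_1, the measure mu on Mplus is, up to
   sign, dxi_2 dxi_3 deta_2 deta_3: Lebesgue measure of R^4 read through
   chart. *)
Definition chart (R : realType) (m : 'I_3 -> R) (x : phase R) : 'rV[R]_4 :=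
  \row_(j < 4) [:: xi m x b2 ord0; xi m x b3 ord0;
                   eta m x b2 ord0; eta m x b3 ord0]`_j.

(* [Order.max 0] only serves to give the empty set diameter 0. *)
Definition diam (R : realType) (n : nat) (A : set 'rV[R]_n.+1) : \bar R :=
  Order.max 0%E
    (ereal_sup [set r | exists x y, [/\ A x, A y & r = (`|x - y|)%:E]]).

Definition hausdorff_pre (R : realType) (n d : nat) (delta : R)
    (A : set 'rV[R]_n.+1) : \bar R :=
  ereal_inf [set s | exists F : nat -> set 'rV[R]_n.+1,
    [/\ A `<=` \bigcup_k F k, (forall k, (diam (F k) <= delta%:E)%E)
      & s = (\sum_(0 <= k <oo) (diam (F k) ^+ d))%E]].

(* d-dimensional Hausdorff (outer) measure on R^(n+1) for the sup norm; it is
   comparable, up to constant factors, with the Euclidean one, hence with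
   d-dimensional area on d-dimensional submanifolds. *)
Definition hausdorff (R : realType) (n d : nat) (A : set 'rV[R]_n.+1) : \bar R :=
  ereal_sup [set hausdorff_pre d delta A | delta in [set delta : R | 0 < delta]].

(* The smooth measure induced by mu on the codimension one manifold S: the
   three-dimensional area in the coordinates in which mu is the volume. *)
Definition muS (R : realType) (m : 'I_3 -> R) (S A : set (phase R)) : \bar R :=
  hausdorff 3 (chart m @` (S `&` A)).

Definition muS_ae (R : realType) (m : 'I_3 -> R) (S : set (phase R))
    (P : phase R -> Prop) : Prop :=
  muS m S [set x | ~ P x] = 0%E.

(* A tangent vector (delta xi, delta eta). *)
Definition tvec (R : realType) : Type := ('cV[R]_3 * 'cV[R]_3)%type.

(* The sum of L_1 and L_2. *)
Definition L12 (R : realType) : set (tvec R) :=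
  [set w : tvec R | w.1 b1 ord0 = 0 /\ w.2 b1 ord0 = 0].

Definition Q (R : realType) (w : tvec R) : R :=
  \sum_(i < 3) w.1 i ord0 * w.2 i ord0.

Definition cone (R : realType) : set (tvec R) :=
  [set w : tvec R | L12 w /\ 0 < Q w] `|` [set 0].
Definition cone' (R : realType) : set (tvec R) :=
  [set w : tvec R | L12 w /\ Q w < 0] `|` [set 0].

(* In [alpha], [beta], [dPhi] and [dPhiV], z is the state right before the
   collision. *)
Definition alpha (R : realType) (m : 'I_3 -> R) (i j : 'I_3) (z : phase R) : R :=
  2 * m i * m j * (m i - m j) * (vel m z i - vel m z j) / (m i + m j) ^+ 2.

Definition beta (R : realType) (m : 'I_3 -> R) (z : phase R) : R :=
  - (2 / (m b1 * vel m z b1)).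

Definition dPhi (R : realType) (m : 'I_3 -> R) (k : wall) (z : phase R)
    (w : tvec R) : tvec R :=
  let x i := w.1 i ord0 in let y i := w.2 i ord0 in
  match k with
  | Floor => (w.1, col3 (y b1) (y b2 + beta m z * x b2) (y b3))
  | Balls12 => let g := gamma m b1 b2 in
      (col3 (x b1) (- x b2 + (1 + g) * x b3 - alpha m b1 b2 z * y b2) (x b3),
       col3 (y b1) (- y b2) ((1 + g) * y b2 + y b3))
  | Balls23 => let g := gamma m b2 b3 in
      (col3 (x b1) (x b2) ((1 - g) * x b2 - x b3 - alpha m b2 b3 z * y b3),
       col3 (y b1) (y b2 + (1 - g) * y b3) (- y b3))
  end.

(* The inverse of [dPhi m k z]; see [dPhiK] and [dPhiVK]. *)
Definition dPhiV (R : realType) (m : 'I_3 -> R) (k : wall) (z : phase R)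
    (w : tvec R) : tvec R :=
  let x i := w.1 i ord0 in let y i := w.2 i ord0 in
  match k with
  | Floor => (w.1, col3 (y b1) (y b2 - beta m z * x b2) (y b3))
  | Balls12 => let g := gamma m b1 b2 in
      (col3 (x b1) (- x b2 + (1 + g) * x b3 + alpha m b1 b2 z * y b2) (x b3),
       col3 (y b1) (- y b2) ((1 + g) * y b2 + y b3))
  | Balls23 => let g := gamma m b2 b3 in
      (col3 (x b1) (x b2) ((1 - g) * x b2 - x b3 + alpha m b2 b3 z * y b3),
       col3 (y b1) (y b2 + (1 - g) * y b3) (- y b3))
  end.

Lemma col3_eta (R : realType) (u : 'cV[R]_3) :
  col3 (u b1 ord0) (u b2 ord0) (u b3 ord0) = u.
Proof.
apply/matrixP => i j; rewrite !mxE (ord1 j).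
by case: i => [[|[|[|//]]] hi] /=; congr (u _ _); apply: val_inj.
Qed.

Lemma dPhiK (R : realType) (m : 'I_3 -> R) k (z : phase R) :
  cancel (dPhi m k z) (dPhiV m k z).
Proof.
move=> [u v]; rewrite -(col3_eta u) -(col3_eta v); case: k;
  rewrite /dPhi /dPhiV /= !mxE /=; congr (_, _); congr col3; ring.
Qed.

Lemma dPhiVK (R : realType) (m : 'I_3 -> R) k (z : phase R) :
  cancel (dPhiV m k z) (dPhi m k z).
Proof.
move=> [u v]; rewrite -(col3_eta u) -(col3_eta v); case: k;
  rewrite /dPhi /dPhiV /= !mxE /=; congr (_, _); congr col3; ring.
Qed.

(* s 0 = x, ..., s n is a branch of x, ..., T^n x; k i is the collision that
   occurs between s i and s i.+1. *)
Definition fbranch (R : realType) (m : 'I_3 -> R) (c : R) (n : nat)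
    (x : phase R) (s : nat -> phase R) (k : nat -> wall) : Prop :=
  s 0%N = x /\ forall i, (i < n)%N -> step m c (k i) (s i) (s i.+1).

(* s 0 = x, ..., s n is a branch of x, ..., T^-n x. *)
Definition bbranch (R : realType) (m : 'I_3 -> R) (c : R) (n : nat)
    (x : phase R) (s : nat -> phase R) (k : nat -> wall) : Prop :=
  s 0%N = x /\ forall i, (i < n)%N -> step m c (k i) (s i.+1) (s i).

(* All iterates of T (resp. of its inverse) are defined at x, along every
   branch. *)
Definition fdefined (R : realType) (m : 'I_3 -> R) (c : R) (x : phase R) : Prop :=
  forall n s k, fbranch m c n x s k -> exists l y, step m c l (s n) y.
Definition bdefined (R : realType) (m : 'I_3 -> R) (c : R) (x : phase R) : Prop :=
  forall n s k, bbranch m c n x s k -> exists l y, step m c l y (s n).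

(* The derivative of T^n at s 0, along a forward branch (s, k). *)
Fixpoint dTn (R : realType) (m : 'I_3 -> R) (c : R) (s : nat -> phase R)
    (k : nat -> wall) (n : nat) (w : tvec R) : tvec R :=
  if n is n'.+1 then dPhi m (k n') (hit m c (s n')) (dTn m c s k n' w) else w.

(* The derivative of T^-n at s 0, along a backward branch (s, k). *)
Fixpoint dTVn (R : realType) (m : 'I_3 -> R) (c : R) (s : nat -> phase R)
    (k : nat -> wall) (n : nat) (w : tvec R) : tvec R :=
  if n is n'.+1 then dPhiV m (k n') (hit m c (s n'.+1)) (dTVn m c s k n' w)
  else w.

(* Main.v *)
(** Along the orbit Q never decreases: the gains are beta (delta xi_2)^2 at the
    floor, alpha_1 (delta eta_2)^2 and alpha_2 (delta eta_3)^2 at the collisions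
    of the balls.  If Q stays bounded, the gains in late windows of bounded
    duration are at most eps^2 with eps small, and it suffices to find in each
    window a tangent vector of norm O(eps): its Q is then O(eps^2), although Q
    cannot drop below a positive value that it has taken.

    The mass condition says that the linear parts of the collisions 12 and 23
    generate the Weyl group A_2.  Hence at most three collisions of balls occur
    between two floor collisions, and delta xi, small at the floor, is O(eps)
    throughout the window, measured in a norm invariant under the group.  As to
    delta eta, delta eta_3 is constant up to sign between two collisions 12, and
    the kicks that ball 3 receives in between are bounded by the relative
    velocities at these two collisions, since v_1 - v_2 increases in between and
    changes sign at them.  As the kicks of ball 3 must balance gravity, the gains
    at the collisions 12 and 23 make delta eta of order eps somewhere.

    This works along every infinite branch; backward branches reduce to forward
    ones by reversing the momenta.  T or its inverse can only be undefined after
    a tangential contact.  In the chart such states form two-dimensional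
    surfaces, and the collision maps are locally Lipschitz there, so the initial
    points concerned form a set of zero three-dimensional Hausdorff measure. *)

Require Import Defs.
From HB Require Import structures.
From mathcomp Require Import all_boot all_order all_algebra.
From mathcomp Require Import all_classical all_reals all_analysis.
From mathcomp Require Import ring lra zify.
Set Implicit Arguments.
Unset Strict Implicit.
Unset Printing Implicit Defensive.

Import Order.TTheory GRing.Theory Num.Theory.
Import numFieldNormedType.Exports.
Local Open Scope classical_set_scope.
Local Open Scope ring_scope.

(** * Order of the collisions and balance of the kicks against gravity *)

Section Velocities.
Context {R : realType}.
Variables (p r V : R) (k : nat -> wall) (v1 v2 v3 t : nat -> R).

Definition kick1 i := if k i is Floor then - v1 i else 0.
Definition kick2 i := if k i is Balls12 then v1 i - v2 i else 0.
Definition kick3 i := if k i is Balls23 then v2 i - v3 i else 0.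

(* p = 1 + gamma_1 and r = 1 - gamma_2; the mass condition is p r = 1.  The
   velocities at step i are those right before the collision k i, and t i is
   the time from this collision to the next one. *)
Record velocity_law : Prop := VelocityLaw {
  pr1 : p * r = 1;
  p_gt1 : 1 < p;
  p_lt2 : p < 2;
  r_gt0 : 0 < r;
  r_lt1 : r < 1;
  t_ge0 : forall i, 0 <= t i;
  v1_lt0 : forall i, k i = Floor -> v1 i < 0;
  v2_lt_v1 : forall i, k i = Balls12 -> v2 i < v1 i;
  v3_lt_v2 : forall i, k i = Balls23 -> v3 i < v2 i;
  v1S : forall i, v1 i.+1 = v1 i - t i + 2 * kick1 i - (2 - p) * kick2 i;
  v2S : forall i, v2 i.+1 = v2 i - t i + p * kick2 i - r * kick3 i;
  v3S : forall i, v3 i.+1 = v3 i - t i + (2 - r) * kick3 i;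
  v1_le : forall i, `|v1 i| <= V;
  v2_le : forall i, `|v2 i| <= V;
  v3_le : forall i, `|v3 i| <= V }.

Hypothesis vl : velocity_law.

Lemma kick1_ge0 i : 0 <= kick1 i.
Proof. by rewrite /kick1; case E: (k i) => //; have := v1_lt0 vl E; lra. Qed.

Lemma kick2_ge0 i : 0 <= kick2 i.
Proof. by rewrite /kick2; case E: (k i) => //; have := v2_lt_v1 vl E; lra. Qed.

Lemma kick3_ge0 i : 0 <= kick3 i.
Proof. by rewrite /kick3; case E: (k i) => //; have := v3_lt_v2 vl E; lra. Qed.

Lemma V_ge0 : 0 <= V.
Proof. exact: le_trans (normr_ge0 _) (v1_le vl 0%N). Qed.

Lemma v1_bd i : - V <= v1 i <= V. Proof. by rewrite -ler_norml (v1_le vl). Qed.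
Lemma v2_bd i : - V <= v2 i <= V. Proof. by rewrite -ler_norml (v2_le vl). Qed.
Lemma v3_bd i : - V <= v3 i <= V. Proof. by rewrite -ler_norml (v3_le vl). Qed.

Lemma kick2_le i : kick2 i <= 2 * V.
Proof.
by rewrite /kick2; have := V_ge0; have := v1_bd i; have := v2_bd i;
  case: (k i) => //; lra.
Qed.

Lemma kick3_le i : kick3 i <= 2 * V.
Proof.
by rewrite /kick3; have := V_ge0; have := v2_bd i; have := v3_bd i;
  case: (k i) => //; lra.
Qed.

(* In the coordinates (v1 - v2, (v2 - v3) / p) the collisions 12 and 23 act as
   the simple reflections of the Weyl group A_2, whose longest element has
   length 3. *)
Lemma floor_within4 i : exists2 j, (j < 4)%N & k (i + j)%N = Floor.
Proof.
have [pr p1 p2 r0 r1 _ _ g12 g23 e1 e2 e3 _ _ _] := vl.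
case E0: (k i); first by exists 0%N; rewrite ?addn0.
all: case E1: (k i.+1); first by exists 1%N; rewrite ?addn1.
all: case E2: (k i.+2); first by exists 2%N; rewrite ?addn2.
all: case E3: (k i.+3); first by exists 3%N; rewrite ?addn3.
all: exfalso.
all: move: (g12 i) (g12 i.+1) (g12 i.+2) (g12 i.+3)
  (g23 i) (g23 i.+1) (g23 i.+2) (g23 i.+3).
all: move: (e1 i) (e1 i.+1) (e1 i.+2).
all: move: (e2 i) (e2 i.+1) (e2 i.+2) (e3 i) (e3 i.+1) (e3 i.+2).
all: rewrite /kick1 /kick2 /kick3 E0 E1 E2 E3 !(mulr0, addr0, subr0).
all: move=> a0 a1 a2 b0 b1 b2 c0 c1 c2 h0 h1 h2 h3 h4 h5 h6 h7.
all: do ?[move: (h0 erefl) => {}h0 | move: (h4 erefl) => {}h4].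
all: do ?[move: (h1 erefl) => {}h1 | move: (h5 erefl) => {}h5].
all: do ?[move: (h2 erefl) => {}h2 | move: (h6 erefl) => {}h6].
all: do ?[move: (h3 erefl) => {}h3 | move: (h7 erefl) => {}h7].
(* [lra] excludes two equal collisions in a row, since a collision reverses its own relative
   velocity. Two alternating words remain; in each, the relative velocity before the fourth
   collision is a negative multiple of the one before the first. *)
all: try lra.
- have x2 : v1 i.+2 - v2 i.+2 = r * (v2 i - v3 i).
    rewrite c1 c0 a1 a0 b0.
    have -> : v2 i = v2 i * (p * r) by rewrite pr mulr1.
    by ring: pr.
  have y3 : v2 i.+3 - v3 i.+3 = - p * (v1 i - v2 i).
    rewrite a2 b2 x2 a1 b1 a0 b0.
    by ring: pr.
  have : 0 < p * (v1 i - v2 i) by apply: mulr_gt0; lra.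
  lra.
- have y2 : v2 i.+2 - v3 i.+2 = p * (v1 i - v2 i).
    rewrite a1 b1 c0 a0 b0.
    by ring: pr.
  have x3 : v1 i.+3 - v2 i.+3 = - r * (v2 i - v3 i).
    rewrite a2 c2 y2 a1 c1 a0 c0.
    by ring: pr.
  have : 0 < r * (v2 i - v3 i) by apply: mulr_gt0; lra.
  lra.
Qed.

Local Notation S f N n := (\sum_(N <= i < n) f i).

Lemma sum_shift (f g : nat -> R) N n : (N <= n)%N ->
  (forall i, f i.+1 = f i + g i) -> S g N n = f n - f N.
Proof. by move=> Nn fg; rewrite -telescope_sumr //; apply: eq_bigr => i _; rewrite fg; ring. Qed.

(** Here and in the next two identities, gravity takes the elapsed time from the velocity of a ball,
    the kicks from below add to it and those from above reduce it; the velocity changes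
    telescope. *)
Lemma sum_kick3 N n : (N <= n)%N ->
  (2 - r) * S kick3 N n = S t N n + v3 n - v3 N.
Proof.
move=> Nn; have -> : S t N n + v3 n - v3 N = S t N n + (v3 n - v3 N) by ring.
rewrite -(@sum_shift v3 (fun i => (2 - r) * kick3 i - t i)) //.
  by rewrite !sumrB -!mulr_sumr; ring.
by move=> i; rewrite (v3S vl); ring.
Qed.

Lemma sum_kick2 N n : (N <= n)%N ->
  p * S kick2 N n = S t N n + v2 n - v2 N + r * S kick3 N n.
Proof.
move=> Nn; have -> : S t N n + v2 n - v2 N = S t N n + (v2 n - v2 N) by ring.
rewrite -(@sum_shift v2 (fun i => p * kick2 i - t i - r * kick3 i)) //.
  by rewrite !sumrB -!mulr_sumr; ring.
by move=> i; rewrite (v2S vl); ring.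
Qed.

Lemma sum_kick1 N n : (N <= n)%N ->
  2 * S kick1 N n = S t N n + v1 n - v1 N + (2 - p) * S kick2 N n.
Proof.
move=> Nn; have -> : S t N n + v1 n - v1 N = S t N n + (v1 n - v1 N) by ring.
rewrite -(@sum_shift v1 (fun i => 2 * kick1 i - t i - (2 - p) * kick2 i)) //.
  by rewrite !sumrB -!mulr_sumr; ring.
by move=> i; rewrite (v1S vl); ring.
Qed.

Lemma kick3_lb N n : (N <= n)%N -> S t N n - 2 * V <= 2 * S kick3 N n.
Proof.
move=> Nn; have := sum_kick3 Nn; have := v3_bd n; have := v3_bd N.
have : 0 <= S kick3 N n by apply: sumr_ge0 => i _; exact: kick3_ge0.
have := r_gt0 vl; nra.
Qed.

Lemma kick3_ub N n : (N <= n)%N -> S kick3 N n <= S t N n + 2 * V.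
Proof.
move=> Nn; have := sum_kick3 Nn; have := v3_bd n; have := v3_bd N.
have : 0 <= S kick3 N n by apply: sumr_ge0 => i _; exact: kick3_ge0.
have := r_lt1 vl; nra.
Qed.

Lemma kick2_ub N n : (N <= n)%N -> S kick2 N n <= 2 * S t N n + 4 * V.
Proof.
move=> Nn; have := sum_kick2 Nn; have := v2_bd n; have := v2_bd N.
have := kick3_ub Nn.
have : 0 <= S kick3 N n by apply: sumr_ge0 => i _; exact: kick3_ge0.
have : 0 <= S kick2 N n by apply: sumr_ge0 => i _; exact: kick2_ge0.
have := r_lt1 vl; have := r_gt0 vl; have := p_gt1 vl; nra.
Qed.

Lemma kick1_ub N n : (N <= n)%N -> S kick1 N n <= 3 * S t N n + 6 * V.
Proof.
move=> Nn; have := sum_kick1 Nn; have := v1_bd n; have := v1_bd N.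
have := kick2_ub Nn.
have : 0 <= S kick2 N n by apply: sumr_ge0 => i _; exact: kick2_ge0.
have : 0 <= S t N n by apply: sumr_ge0 => i _; exact: t_ge0.
have := p_gt1 vl; have := p_lt2 vl; nra.
Qed.

(** The collision raises [v3] by at most [4 * V], the fall lowers it by [t i], and the net change is
    at most [2 * V]. *)
Lemma time_le i : t i <= 6 * V.
Proof.
have := v3S vl i; have := v3_bd i; have := v3_bd i.+1; have := kick3_le i.
by have := kick3_ge0 i; have := r_gt0 vl; nra.
Qed.

(** Without floor collisions ball 1 is only pushed down, by gravity and by ball 2, and its velocity
    stays in an interval of length [2 * V]. *)
Lemma ex_floor N n : (N <= n)%N -> 2 * V < S t N n ->
  exists2 i, (N <= i < n)%N & k i = Floor.
Proof.
move=> Nn Tn; apply: contrapT => nF.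
have K0 : S kick1 N n = 0.
  rewrite big_nat big1 // => i iN; rewrite /kick1; case E: (k i) => //.
  by case: nF; exists i.
have := sum_kick1 Nn; rewrite K0; have := v1_bd n; have := v1_bd N.
have : 0 <= S kick2 N n by apply: sumr_ge0 => i _; exact: kick2_ge0.
have := p_lt2 vl; nra.
Qed.

(** Without collisions 12, ball 2 is only pushed down, by gravity and by ball 3. *)
Lemma ex_balls12 N n : (N <= n)%N -> 2 * V < S t N n ->
  exists2 i, (N <= i < n)%N & k i = Balls12.
Proof.
move=> Nn Tn; apply: contrapT => nF.
have K0 : S kick2 N n = 0.
  rewrite big_nat big1 // => i iN; rewrite /kick2; case E: (k i) => //.
  by case: nF; exists i.
have := sum_kick2 Nn; rewrite K0; have := v2_bd n; have := v2_bd N.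
have : 0 <= S kick3 N n by apply: sumr_ge0 => i _; exact: kick3_ge0.
have := r_gt0 vl; nra.
Qed.

(** Collisions do not accumulate in time; [time_diverges_of_energy] derives this from the
    conservation of energy. *)
Definition time_diverges := forall N A, exists2 n, (N <= n)%N & A <= S t N n.

Lemma ex_time N L : time_diverges -> 0 <= L ->
  exists2 n, (N <= n)%N & L <= S t N n <= L + 6 * V.
Proof.
move=> td L0; have [n0 Nn0 Ln0] := td N L.
pose P n := (N <= n)%N && (L <= S t N n).
have exP : exists n, P n by exists n0; rewrite /P Nn0.
(* The least such [n] overshoots [L] by at most one step, hence by [6 * V]. *)
case: (ex_minnP exP) => n /andP[Nn Ln] nmin; exists n => //; rewrite Ln /=.
move: Nn; rewrite leq_eqVlt => /orP[/eqP nN|Nn].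
  by rewrite -nN big_geq //; have := V_ge0; lra.
case: n Nn Ln nmin => // n Nn Ln nmin; rewrite big_nat_recr //=.
have : ~~ P n by apply/negP => /nmin; rewrite ltnn.
rewrite /P -ltnS Nn /= -ltNge => nL.
by have := time_le n; lra.
Qed.

End Velocities.

(** Past an index where [f] is within [eps] of its supremum, it stays so. This serves both for Q and
    for the accumulated time and kicks. *)
Lemma tail_small (R : realType) (f : nat -> R) (M eps : R) : 0 < eps ->
  {homo f : i j / (i <= j)%N >-> i <= j} -> (forall i, f i <= M) ->
  exists N, forall i j, (N <= i <= j)%N -> f j - f i <= eps.
Proof.
move=> e0 fm fM.
have hs : has_sup (range f).
  by split; [exists (f 0%N), 0%N|exists M => _ [i _ <-]].
have [_ [N _ <-] fN] := sup_adherent e0 hs.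
exists N => i j /andP[Ni ij]; have := fm _ _ Ni.
have : f j <= sup (range f) by apply: sup_ubound; [case: hs|exists j].
lra.
Qed.

(** * Growth of the quadratic form along a tangent orbit *)

Section Tangent.
Context {R : realType}.
Variables (p r V : R) (k : nat -> wall) (v1 v2 v3 t : nat -> R).
Variables (a1 a2 b0 : R) (B : nat -> R) (x2 x3 y2 y3 : nat -> R).

Local Notation G := (kick2 k v1 v2).
Local Notation J := (kick3 k v2 v3).

(* (x2, x3, y2, y3) stands for (delta xi_2, delta xi_3, delta eta_2,
   delta eta_3), so that a1 * kick2 and a2 * kick3 are the alphas. *)
Record tangent_law : Prop := TangentLaw {
  a1_gt0 : 0 < a1;
  a2_gt0 : 0 < a2;
  b0_gt0 : 0 < b0;
  B_ge : forall i, b0 <= B i;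
  x2S : forall i, x2 i.+1 =
    if k i is Balls12 then - x2 i + p * x3 i - a1 * G i * y2 i else x2 i;
  x3S : forall i, x3 i.+1 =
    if k i is Balls23 then r * x2 i - x3 i - a2 * J i * y3 i else x3 i;
  y2S : forall i, y2 i.+1 =
    match k i with
    | Floor => y2 i + B i * x2 i
    | Balls12 => - y2 i
    | Balls23 => y2 i + r * y3 i
    end;
  y3S : forall i, y3 i.+1 =
    match k i with
    | Floor => y3 i
    | Balls12 => p * y2 i + y3 i
    | Balls23 => - y3 i
    end }.

Hypothesis vl : velocity_law p r V k v1 v2 v3 t.
Hypothesis tl : tangent_law.

Definition Qf i := x2 i * y2 i + x3 i * y3 i.
Definition gain i := (if k i is Floor then B i * x2 i ^+ 2 else 0)
  + a1 * G i * y2 i ^+ 2 + a2 * J i * y3 i ^+ 2.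

(** The linear part of a collision acts on [(y2, y3)] by the contragredient of its action on
    [(x2, x3)] and so preserves [Qf]; only the shears contribute. *)
Lemma QfS i : Qf i.+1 = Qf i + gain i.
Proof.
rewrite /Qf /gain (x2S tl) (x3S tl) (y2S tl) (y3S tl) /kick2 /kick3.
by case: (k i); ring: (pr1 vl).
Qed.

Lemma gain_ge0 i : 0 <= gain i.
Proof.
have := kick2_ge0 vl i; have := kick3_ge0 vl i => J0 G0.
have [A1 A2 b00 B0 _ _ _ _] := tl.
apply: addr_ge0; last exact: mulr_ge0 (mulr_ge0 (ltW A2) J0) (sqr_ge0 _).
apply: addr_ge0; last exact: mulr_ge0 (mulr_ge0 (ltW A1) G0) (sqr_ge0 _).
by case: (k i) => //; rewrite mulr_ge0 ?sqr_ge0 //; have := B0 i; lra.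
Qed.

Lemma Qf_mono N n : (N <= n)%N -> Qf N <= Qf n.
Proof.
elim: n => [|n IH]; first by rewrite leqn0 => /eqP ->.
rewrite leq_eqVlt => /orP[/eqP -> //|]; rewrite ltnS => /IH.
by rewrite QfS; have := gain_ge0 n; lra.
Qed.

Lemma sum_gain N n : (N <= n)%N -> \sum_(N <= i < n) gain i = Qf n - Qf N.
Proof. by move=> Nn; apply: sum_shift => // i; exact: QfS. Qed.

Lemma gain_le N n i : (N <= i < n)%N -> gain i <= Qf n - Qf N.
Proof.
move=> /andP[Ni iN]; have := Qf_mono Ni; have := Qf_mono iN; rewrite QfS; lra.
Qed.

Let am := Num.min a1 a2.

(* [light i] tells whether y3 is small; it changes only at collisions 12, and
   y2 is not small at a collision 12 next to a light stretch.  Along a light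
   stretch v_1 - v_2 increases at least by r times the kicks of ball 3, and a
   collision 12 reverses its sign: these kicks are controlled by those of
   the heavy collisions 12. *)
Lemma light_step s (light := fun i => (`|y3 i| < s)%R)
    (f := fun i => if light i then v1 i - v2 i else 0) i :
  0 < s -> s <= `|y2 i| \/ 3 * s <= `|y3 i| ->
  am * s ^+ 2 * (r * J i) <= am * s ^+ 2 * (f i.+1 - f i) + 2 * gain i.
Proof.
move=> s0 ys.
have am0 : 0 < am by rewrite lt_min (a1_gt0 tl) (a2_gt0 tl).
have am1 : am <= a1 by rewrite ge_min lexx.
have am2 : am <= a2 by rewrite ge_min lexx orbT.
have as0 : 0 < am * s ^+ 2 by rewrite mulr_gt0 // exprn_gt0.
have [pr p1 p2 r0 r1 _ _ _ _ _ _ _ _ _ _] := vl.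
have := gain_ge0 i; have := kick2_ge0 vl i; have := kick3_ge0 vl i.
have := v1S vl i; have := v2S vl i; have := y3S tl i.
rewrite /f /light /gain /kick1 /kick2 /kick3.
case E: (k i); rewrite !(mulr0, mul0r, addr0, subr0, add0r).
- move=> -> ev2 ev1 _ _; rewrite ev1 ev2.
  have := v1_lt0 vl E.
  case: ifP => _ vneg gn; last by lra.
  have : 0 <= am * s ^+ 2 * (v1 i - t i + 2 * - v1 i - (v2 i - t i) - (v1 i - v2 i)).
    by apply: mulr_ge0; lra.
  lra.
- move=> -> ev2 ev1 _ g0 gn.
  have ev : v1 i.+1 - v2 i.+1 = - (v1 i - v2 i) by rewrite ev1 ev2; ring.
  have [ys2|ys2] := leP s `|y2 i|.
    have y2s : s ^+ 2 <= y2 i ^+ 2 by rewrite -[leRHS]real_normK ?num_real // lerXn2r // nnegrE // ltW.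
    have h : am * s ^+ 2 * (v1 i - v2 i) <= a1 * (v1 i - v2 i) * y2 i ^+ 2.
      rewrite mulrAC ler_pM ?sqr_ge0 //; first by rewrite mulr_ge0 // ltW.
      by rewrite ler_wpM2r.
    (* At this collision [f] drops by at most [2 * (v1 i - v2 i)], the worst case being light on
       both sides; hence the factor 2 before [gain i]. *)
    rewrite ev; move: h g0 as0; move: (am * s ^+ 2) => w h g0 as0.
    by case: ifP; case: ifP => _ _; nra.
  (* Here |p y2| is at most 2 s because p < 2. Since |y3| is at least 3 s before the collision, it
     is at least s after it, and neither side is light. *)
  have ys3 : 3 * s <= `|y3 i| by case: ys => // ?; lra.
  have ys4 : s <= `|p * y2 i + y3 i|.
    have h : `|p * y2 i| <= 2 * s.
      rewrite normrM ger0_norm; last by lra.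
      by have := normr_ge0 (y2 i); nra.
    have := ler_normB (p * y2 i + y3 i) (p * y2 i).
    have -> : p * y2 i + y3 i - p * y2 i = y3 i by ring.
    lra.
  rewrite !ifF; first by lra.
    by apply/negbTE; rewrite -leNgt; lra.
  by apply/negbTE; rewrite -leNgt; lra.
- move=> -> ev2 ev1 g0 _ gn; rewrite normrN.
  case: ifP => [l|/negbT]; first by rewrite ev1 ev2; lra.
  rewrite -leNgt => ys3.
  have y3s : s ^+ 2 <= y3 i ^+ 2 by rewrite -[leRHS]real_normK ?num_real // lerXn2r // nnegrE // ltW.
  have h : am * s ^+ 2 * (v2 i - v3 i) <= a2 * (v2 i - v3 i) * y3 i ^+ 2.
    rewrite mulrAC ler_pM ?sqr_ge0 //; first by rewrite mulr_ge0 // ltW.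
    by rewrite ler_wpM2r.
  move: h g0 as0; move: (am * s ^+ 2) => w h g0 as0.
  have : w * (r * (v2 i - v3 i)) <= w * (v2 i - v3 i).
    by apply: ler_wpM2l; [exact: ltW|apply: ler_piMl => //; exact: ltW].
  lra.
Qed.

(** Otherwise [light_step] holds throughout the window. In the sum, [f] telescopes and contributes
    at most [4 * V], and the gains contribute at most [2 * eps ^+ 2]; the kicks of ball 3 exceed
    this. *)
Lemma eta_small N n (eps : R) : (N <= n)%N -> 0 < eps ->
  4 * V + 1 <= r * \sum_(N <= i < n) J i -> Qf n - Qf N <= eps ^+ 2 ->
  exists2 i, (N <= i < n)%N &
    `|y2 i| < (1 + 2 / am) * eps /\ `|y3 i| < 3 * ((1 + 2 / am) * eps).
Proof.
move=> Nn e0 Jl Qe; apply: contrapT => none.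
have am0 : 0 < am by rewrite lt_min (a1_gt0 tl) (a2_gt0 tl).
(* The factor is chosen so that am (1 + 2 / am)^2 = am + 4 + 4 / am is greater than 2. *)
set s := (1 + 2 / am) * eps in none.
have s0 : 0 < s by rewrite mulr_gt0 // addr_gt0 // divr_gt0.
pose f i := if `|y3 i| < s then v1 i - v2 i else 0.
have st i : (N <= i < n)%N ->
    am * s ^+ 2 * (r * J i) <= am * s ^+ 2 * (f i.+1 - f i) + 2 * gain i.
  move=> iN; apply: light_step => //; apply: contrapT => /not_orP[].
  by move=> /negP; rewrite -ltNge => h1 /negP; rewrite -ltNge => h2; apply: none; exists i.
have {st} : \sum_(N <= i < n) (am * s ^+ 2 * (r * J i)) <=
    \sum_(N <= i < n) (am * s ^+ 2 * (f i.+1 - f i) + 2 * gain i).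
  by rewrite [leLHS]big_nat [leRHS]big_nat; apply: ler_sum => i /st.
rewrite big_split /= -!mulr_sumr telescope_sumr // sum_gain //.
have fb i : - (2 * V) <= f i <= 2 * V.
  rewrite /f; have := v1_bd vl i; have := v2_bd vl i; have := V_ge0 vl.
  by case: ifP => _; lra.
have := fb n; have := fb N.
have w2 : 2 * eps ^+ 2 < am * s ^+ 2.
  have -> : am * s ^+ 2 = (am + 4 + 4 / am) * eps ^+ 2.
    by rewrite /s; field; rewrite gt_eqF.
  rewrite ltr_pM2r ?exprn_gt0 //.
  by have : 0 < 4 / am; [rewrite divr_gt0|lra].
by move: w2; move: (am * s ^+ 2) => w w2 f1 f2; nra.
Qed.

(** The forms [x2], [p * x3 - x2] and [- (p * x3)] have sum zero, and the group A_2 permutes them as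
    S_3 permutes three coordinates; this is their l^1 norm. *)
Definition nrm i := `|x2 i| + `|p * x3 i| + `|x2 i - p * x3 i|.

(** As |y| is at most eps + y^2 / eps, a shear, linear in y, is controlled by a gain, quadratic in
    y. *)
Lemma shear_le (al eps y : R) : 0 <= al -> 0 < eps ->
  `|al * y| <= eps * al + al * y ^+ 2 / eps.
Proof.
move=> al0 e0; rewrite normrM (ger0_norm al0).
have -> : eps * al + al * y ^+ 2 / eps = al * (eps + `|y| ^+ 2 / eps).
  by rewrite real_normK ?num_real //; ring.
apply: ler_wpM2l => //; have := normr_ge0 y; move: `|y| => z z0.
have [ze|ze] := leP z eps.
  have : 0 <= z ^+ 2 / eps by apply: divr_ge0; [exact: sqr_ge0|exact: ltW].
  lra.
have : z <= z ^+ 2 / eps by rewrite ler_pdivlMr // expr2 ler_wpM2l // ltW.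
lra.
Qed.

Definition shear i := `|a1 * G i * y2 i| + `|a2 * J i * y3 i|.

(* The linear parts of the collisions permute the three terms of nrm. *)
Lemma nrm_step i : `|nrm i.+1 - nrm i| <= 4 * shear i.
Proof.
have [pr p1 p2 r0 r1 _ _ _ _ _ _ _ _ _ _] := vl.
rewrite /nrm /shear (x2S tl) (x3S tl).
have s0 := normr_ge0 (a1 * G i * y2 i); have s1 := normr_ge0 (a2 * J i * y3 i).
case: (k i).
- by rewrite subrr normr0; lra.
- move: s0; set D := a1 * G i * y2 i => s0.
  have -> : - x2 i + p * x3 i - D - p * x3 i = - (x2 i + D) by ring.
  rewrite normrN.
  have h1 := lerB_dist (x2 i + D) (x2 i).
  have h1' := lerB_dist (x2 i) (x2 i + D).
  have h2 := lerB_dist (x2 i - p * x3 i) (- (- x2 i + p * x3 i - D)).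
  have h2' := lerB_dist (- x2 i + p * x3 i - D) (- (x2 i - p * x3 i)).
  move: h1 h1' h2 h2'.
  have -> : x2 i + D - x2 i = D by ring.
  have -> : x2 i - (x2 i + D) = - D by ring.
  have -> : x2 i - p * x3 i - - (- x2 i + p * x3 i - D) = - D by ring.
  have -> : - x2 i + p * x3 i - D - - (x2 i - p * x3 i) = - D by ring.
  rewrite !normrN => h1 h1' h2 h2'.
  by rewrite ler_norml; lra.
- move: s1; set D := a2 * J i * y3 i => s1.
  have -> : p * (r * x2 i - x3 i - D) = x2 i - p * x3 i - p * D by ring: pr.
  have pD : `|p * D| <= 2 * `|D|.
    by rewrite normrM ger0_norm; [apply: ler_wpM2r => //; lra|lra].
  have -> : x2 i - (x2 i - p * x3 i - p * D) = p * x3 i + p * D by ring.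
  have h1 := lerB_dist (p * x3 i + p * D) (p * x3 i).
  have h1' := lerB_dist (p * x3 i) (p * x3 i + p * D).
  have h2 := lerB_dist (x2 i - p * x3 i) (x2 i - p * x3 i - p * D).
  have h2' := lerB_dist (x2 i - p * x3 i - p * D) (x2 i - p * x3 i).
  move: h1 h1' h2 h2'.
  have -> : p * x3 i + p * D - p * x3 i = p * D by ring.
  have -> : p * x3 i - (p * x3 i + p * D) = - (p * D) by ring.
  have -> : x2 i - p * x3 i - (x2 i - p * x3 i - p * D) = p * D by ring.
  have -> : x2 i - p * x3 i - p * D - (x2 i - p * x3 i) = - (p * D) by ring.
  rewrite !normrN => h1 h1' h2 h2'.
  by rewrite ler_norml; lra.
Qed.

Lemma shear_le_gain i (eps : R) : 0 < eps ->
  shear i <= eps * (a1 * G i + a2 * J i) + gain i / eps.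
Proof.
move=> e0; have g0 := kick2_ge0 vl i; have j0 := kick3_ge0 vl i.
have [A1 A2 b00 B0 _ _ _ _] := tl.
have h1 := @shear_le (a1 * G i) eps (y2 i) (mulr_ge0 (ltW A1) g0) e0.
have h2 := @shear_le (a2 * J i) eps (y3 i) (mulr_ge0 (ltW A2) j0) e0.
have h3 : a1 * G i * y2 i ^+ 2 / eps + a2 * J i * y3 i ^+ 2 / eps <= gain i / eps.
  rewrite -mulrDl ler_pM2r ?invr_gt0 // /gain -addrA lerDr.
  by case: (k i) => //; rewrite mulr_ge0 ?sqr_ge0 //; have := B0 i; lra.
by rewrite /shear; lra.
Qed.

(** The shears change [nrm] by at most eps times the kicks, which the duration [T] bounds, plus the
    gains divided by eps. *)
Lemma nrm_drift N n (T eps : R) i j : (N <= i <= n)%N -> (N <= j <= n)%N -> 0 < eps ->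
  \sum_(N <= l < n) t l <= T -> Qf n - Qf N <= eps ^+ 2 ->
  nrm j <= nrm i + 4 * ((a1 + a2) * (2 * T + 4 * V) + 1) * eps.
Proof.
move=> iN jN e0 TT Qe.
have [A1 A2 b00 B0 _ _ _ _] := tl.
have Nn : (N <= n)%N by case/andP: iN => /leq_trans; apply.
have T0 : 0 <= \sum_(N <= l < n) t l by apply: sumr_ge0 => l _; exact: (t_ge0 vl).
pose g l := 4 * shear l.
have g0 l : 0 <= g l by rewrite /g /shear mulr_ge0 // addr_ge0.
have sumg : \sum_(N <= l < n) g l <= 4 * ((a1 + a2) * (2 * T + 4 * V) + 1) * eps.
  apply: (@le_trans _ _ (\sum_(N <= l < n) 4 * (eps * (a1 * G l + a2 * J l) + gain l / eps))).
    by apply: ler_sum => l _; rewrite /g ler_wpM2l // shear_le_gain.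
  rewrite -mulr_sumr big_split /= -mulr_sumr -mulr_suml sum_gain // big_split /= -!mulr_sumr.
  rewrite -mulrA ler_pM2l //.
  have Qe' : (Qf n - Qf N) / eps <= eps by rewrite ler_pdivrMr.
  have kg : \sum_(N <= l < n) G l <= 2 * T + 4 * V by have := kick2_ub vl Nn; lra.
  have kj : \sum_(N <= l < n) J l <= 2 * T + 4 * V.
    by have := kick3_ub vl Nn; have := V_ge0 vl; lra.
  have : eps * (a1 * \sum_(N <= l < n) G l + a2 * \sum_(N <= l < n) J l) <=
         eps * ((a1 + a2) * (2 * T + 4 * V)).
    rewrite ler_pM2l // mulrDl lerD //; by rewrite ler_pM2l.
  lra.
have step l1 l2 : (N <= l1 <= l2)%N -> (l2 <= n)%N ->
    `|nrm l2 - nrm l1| <= \sum_(N <= l < n) g l.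
  move=> /andP[l1N l12] l2n; rewrite -telescope_sumr //.
  apply: (le_trans (ler_norm_sum _ _ _)).
  rewrite (big_cat_nat l1N (leq_trans l12 l2n)) /=.
  rewrite (big_cat_nat l12 l2n) /=.
  apply: (@le_trans _ _ (\sum_(l1 <= l < l2) g l)).
    by apply: ler_sum => l _; exact: nrm_step.
  have h1 : 0 <= \sum_(N <= l < l1) g l by apply: sumr_ge0.
  have h2 : 0 <= \sum_(l2 <= l < n) g l by apply: sumr_ge0.
  lra.
case/andP: iN => Ni ni; case/andP: jN => Nj nj.
have [ij|/ltnW ij] := leqP i j.
  by have := step i j; rewrite Ni ij nj => /(_ isT isT); rewrite ler_norml; lra.
by have := step j i; rewrite Nj ij ni => /(_ isT isT); rewrite ler_norml; lra.
Qed.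

Lemma x2_const i j : (i <= j)%N ->
  (forall l, (i <= l < j)%N -> k l <> Balls12) -> x2 j = x2 i.
Proof.
elim: j => [|j IH]; first by rewrite leqn0 => /eqP ->.
rewrite leq_eqVlt => /orP[/eqP -> //|]; rewrite ltnS => ij nk.
rewrite (x2S tl); have := nk j; rewrite ij ltnSn => /(_ isT).
case: (k j) => // _; apply: IH => // l /andP[il lj]; apply: nk;
  by rewrite il ltnS ltnW.
Qed.

(** The gain at the floor is at least [b0 * x2 i ^+ 2]. The constant [1 + b0^-1] replaces the square
    root of [b0^-1]. *)
Lemma x2_floor N n (eps : R) i : (N <= i < n)%N -> k i = Floor -> 0 < eps ->
  Qf n - Qf N <= eps ^+ 2 -> `|x2 i| <= (1 + b0^-1) * eps.
Proof.
move=> iN ki e0 Qe; have [A1 A2 b00 B0 _ _ _ _] := tl.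
have bi0 : 0 < b0^-1 by rewrite invr_gt0.
have h : b0 * x2 i ^+ 2 <= eps ^+ 2.
  apply: (le_trans _ (le_trans (gain_le iN) Qe)).
  rewrite /gain /kick2 /kick3 ki !(mulr0, mul0r, addr0).
  by rewrite ler_wpM2r ?sqr_ge0.
have h2 : x2 i ^+ 2 <= b0^-1 * eps ^+ 2 by rewrite ler_pdivlMl.
rewrite -ler_sqr ?nnegrE ?normr_ge0 //; last first.
  by apply: mulr_ge0; [lra|exact: ltW].
rewrite real_normK ?num_real //; apply: (le_trans h2).
rewrite exprMn ler_wpM2r ?sqr_ge0 //; nra.
Qed.

(* x2 is small at a floor collision and stays so until the collision 12 at
   step j.  It is small again at the next floor collision, which takes place at
   most three steps later; the collisions in between express p * x3 j through
   these two values of x2, up to the shears. *)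
Lemma xi_small N n (eps : R) i j : (N <= i)%N -> (i <= j)%N -> (j.+4 <= n)%N ->
  k i = Floor -> (forall l, (i <= l < j)%N -> k l <> Balls12) ->
  k j = Balls12 -> 0 < eps -> Qf n - Qf N <= eps ^+ 2 ->
  nrm j <= 2 * (3 * (1 + b0^-1) + 3 * ((a1 + a2) * (4 * V) + 1)) * eps.
Proof.
move=> Ni ij jn ki nk kj e0 Qe; have [A1 A2 b00 B0 _ _ _ _] := tl.
have V0 := V_ge0 vl.
have [j0 j1 j2 j3] : [/\ (N <= j < n)%N, (N <= j.+1 < n)%N, (N <= j.+2 < n)%N
    & (N <= j.+3 < n)%N] by clear -Ni ij jn; split; lia.
have bi0 : 0 < b0^-1 by rewrite invr_gt0.
have xi := x2_floor _ ki e0 Qe; have {}xi : `|x2 i| <= (1 + b0^-1) * eps.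
  by apply: xi; clear -Ni ij jn; lia.
have xj : `|x2 j| <= (1 + b0^-1) * eps by rewrite (x2_const ij nk).
set D := (a1 + a2) * (4 * V) + 1.
have D0 : 0 <= D by rewrite /D addr_ge0 // mulr_ge0 //; [lra|lra].
have sh l : (N <= l < n)%N -> shear l <= D * eps.
  move=> lN; apply: (le_trans (shear_le_gain l e0)).
  have g1 : gain l / eps <= eps.
    by rewrite ler_pdivrMr // -expr2; exact: le_trans (gain_le lN) Qe.
  have g2 : a1 * G l + a2 * J l <= (a1 + a2) * (4 * V).
    have h1 : a1 * G l <= a1 * (2 * V) by apply: ler_wpM2l; [exact: ltW|exact: (kick2_le vl)].
    have h2 : a2 * J l <= a2 * (2 * V) by apply: ler_wpM2l; [exact: ltW|exact: (kick3_le vl)].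
    have h3 : 0 <= a1 * V by rewrite mulr_ge0 // ltW.
    have h4 : 0 <= a2 * V by rewrite mulr_ge0 // ltW.
    lra.
  have -> : D * eps = eps * ((a1 + a2) * (4 * V)) + eps by rewrite /D; ring.
  by apply: lerD => //; apply: ler_wpM2l => //; exact: ltW.
have sh1 l : (N <= l < n)%N -> `|a1 * G l * y2 l| <= D * eps.
  by move=> /sh; rewrite /shear; have := normr_ge0 (a2 * J l * y3 l); lra.
have sh2 l : (N <= l < n)%N -> `|a2 * J l * y3 l| <= D * eps.
  by move=> /sh; rewrite /shear; have := normr_ge0 (a1 * G l * y2 l); lra.
have fl l : (N <= l < n)%N -> k l = Floor -> `|x2 l| <= (1 + b0^-1) * eps.
  by move=> lN kl; exact: (x2_floor lN kl e0 Qe).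
have [pr p1 p2 r0 r1 _ _ g12 g23 e1 e2 e3 _ _ _] := vl.
suff xp : `|p * x3 j| <= (2 * (1 + b0^-1) + 3 * D) * eps.
  rewrite /nrm.
  have := ler_normB (x2 j) (p * x3 j).
  have De0 : 0 <= D * eps by rewrite mulr_ge0 // ltW.
  lra.
have [l l4 kl] := floor_within4 vl j.
have flj := fl (j + l)%N _ kl.
have d0 : `|a1 * G j * y2 j| <= D * eps by apply: sh1.
have x1 := x2S tl j; rewrite kj in x1.
case: l l4 kl flj => [_|[_|[_|[_|//]]]]; rewrite ?addn0 ?addn1 ?addn2 ?addn3.
- by rewrite kj.
- move=> k1 flj; have {}flj : `|x2 j.+1| <= (1 + b0^-1) * eps by apply: flj.
  have -> : p * x3 j = x2 j.+1 + x2 j + a1 * G j * y2 j by rewrite x1; ring.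
  have := ler_normD (x2 j.+1 + x2 j) (a1 * G j * y2 j).
  have := ler_normD (x2 j.+1) (x2 j).
  have De0 : 0 <= D * eps by rewrite mulr_ge0 // ltW.
  lra.
- move=> k2 flj; have {}flj : `|x2 j.+2| <= (1 + b0^-1) * eps by apply: flj.
  (* Step [j.+1] is not a second collision 12, so it leaves [x2] unchanged and the bound at the
     floor holds already at [j.+1]. *)
  have n12 : k j.+1 <> Balls12.
    move=> k1; move: (g12 j kj) (g12 j.+1 k1).
    by rewrite e1 e2 /kick1 /kick2 /kick3 kj; lra.
  have x22 : x2 j.+2 = x2 j.+1 by rewrite (x2S tl); case: (k j.+1) n12.
  rewrite x22 in flj.
  have -> : p * x3 j = x2 j.+1 + x2 j + a1 * G j * y2 j by rewrite x1; ring.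
  have := ler_normD (x2 j.+1 + x2 j) (a1 * G j * y2 j).
  have := ler_normD (x2 j.+1) (x2 j).
  have De0 : 0 <= D * eps by rewrite mulr_ge0 // ltW.
  lra.
- move=> k3 flj; have {}flj : `|x2 j.+3| <= (1 + b0^-1) * eps by apply: flj.
  have De0 : 0 <= D * eps by rewrite mulr_ge0 // ltW.
  case k1 : (k j.+1).
  + have f1 : `|x2 j.+1| <= (1 + b0^-1) * eps by apply: fl.
    have -> : p * x3 j = x2 j.+1 + x2 j + a1 * G j * y2 j by rewrite x1; ring.
    have := ler_normD (x2 j.+1 + x2 j) (a1 * G j * y2 j).
    have := ler_normD (x2 j.+1) (x2 j).
    lra.
  + exfalso; move: (g12 j kj) (g12 j.+1 k1).
    by rewrite e1 e2 /kick1 /kick2 /kick3 kj; lra.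
  have d1 : `|a2 * J j.+1 * y3 j.+1| <= D * eps by apply: sh2.
  have x31 : x3 j.+1 = x3 j by rewrite (x3S tl) kj.
  have x21 : x2 j.+2 = x2 j.+1 by rewrite (x2S tl) k1.
  case k2 : (k j.+2).
  + have f1 : `|x2 j.+1| <= (1 + b0^-1) * eps by rewrite -x21; apply: fl.
    have -> : p * x3 j = x2 j.+1 + x2 j + a1 * G j * y2 j by rewrite x1; ring.
    have := ler_normD (x2 j.+1 + x2 j) (a1 * G j * y2 j).
    have := ler_normD (x2 j.+1) (x2 j).
    lra.
  + have d2 : `|a1 * G j.+2 * y2 j.+2| <= D * eps by apply: sh1.
    have x32 : x3 j.+2 = r * x2 j.+1 - x3 j.+1 - a2 * J j.+1 * y3 j.+1.
      by rewrite (x3S tl) k1.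
    have x23 : x2 j.+3 = - x2 j.+2 + p * x3 j.+2 - a1 * G j.+2 * y2 j.+2.
      by rewrite (x2S tl) k2.
    (* The linear part of the word 12, 23, 12 sends [x2] to [- (p * x3)]; the shear of step [j]
       cancels together with [x2 j.+1]. *)
    have -> : p * x3 j =
        - (x2 j.+3 + (p * (a2 * J j.+1 * y3 j.+1) + a1 * G j.+2 * y2 j.+2)).
      by rewrite x23 x32 x31 x21; ring: pr.
    rewrite normrN.
    have := ler_normD (x2 j.+3) (p * (a2 * J j.+1 * y3 j.+1) + a1 * G j.+2 * y2 j.+2).
    have := ler_normD (p * (a2 * J j.+1 * y3 j.+1)) (a1 * G j.+2 * y2 j.+2).
    have pd : `|p * (a2 * J j.+1 * y3 j.+1)| <= 2 * (D * eps).
      rewrite normrM ger0_norm; last by lra.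
      by have := normr_ge0 (a2 * J j.+1 * y3 j.+1); nra.
    have b1e : 0 <= (1 + b0^-1) * eps by apply: mulr_ge0; [lra|exact: ltW].
    lra.
  + exfalso; move: (g23 j.+1 k1) (g23 j.+2 k2).
    by rewrite (e2 j.+1) (e3 j.+1) /kick2 /kick3 k1; lra.
Qed.

(** The window has a stretch with a floor collision, one with a collision 12, one with enough kicks
    of ball 3 for [eta_small], and four more steps to include the floor collision that [xi_small]
    uses. [nrm_drift] carries the smallness of delta xi to the step where delta eta is small.
    Neither [C] nor [n] depends on [eps]. *)
Lemma window : time_diverges t -> exists2 C, 0 < C &
  forall N, exists2 n, (N <= n)%N & forall eps, 0 < eps ->
    Qf n - Qf N <= eps ^+ 2 -> exists2 i, (N <= i <= n)%N &
      [/\ `|x2 i| <= C * eps, `|x3 i| <= C * eps,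
          `|y2 i| <= C * eps & `|y3 i| <= C * eps].
Proof.
move=> td; have V0 := V_ge0 vl; have [A1 A2 b00 B0 _ _ _ _] := tl.
have r0 := r_gt0 vl; have p1 := p_gt1 vl.
(* By [kick3_lb], a time [L] forces the kicks of ball 3 to reach [(4 * V + 1) / r], as [eta_small]
   requires. *)
set L := 2 * V + 2 * ((4 * V + 1) / r).
have Lr : 0 <= (4 * V + 1) / r by rewrite divr_ge0 ?(ltW r0) //; lra.
have L0 : 0 <= L by rewrite /L; lra.
(* Upper bound of the duration: twice [2 * V + 1 + 6 * V], then [L + 6 * V], then four steps of at
   most [6 * V]. *)
set T := 16 * V + 2 + (L + 6 * V) + 24 * V.
have T0 : 0 <= T by rewrite /T; lra.
have bi0 : 0 < b0^-1 by rewrite invr_gt0.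
set C1 := 2 * (3 * (1 + b0^-1) + 3 * ((a1 + a2) * (4 * V) + 1))
          + 4 * ((a1 + a2) * (2 * T + 4 * V) + 1).
have C10 : 0 < C1.
  have h1 : 0 <= (a1 + a2) * (4 * V) by apply: mulr_ge0; lra.
  have h2 : 0 <= (a1 + a2) * (2 * T + 4 * V) by apply: mulr_ge0; lra.
  by rewrite /C1; lra.
set C2 := 3 * (1 + 2 / Num.min a1 a2).
have C20 : 0 < C2.
  by rewrite mulr_gt0 // addr_gt0 // divr_gt0 // lt_min A1 A2.
exists (C1 + C2); first exact: addr_gt0.
move=> N.
have V1 : 0 <= 2 * V + 1 by lra.
have [n1 Nn1 /andP[T1 T1']] := ex_time vl N td V1.
have [i Ni ki] : exists2 i, (N <= i < n1)%N & k i = Floor.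
  by apply: (ex_floor vl Nn1); lra.
have [n2 n12 /andP[T2 T2']] := ex_time vl n1 td V1.
have [n3 n23 /andP[T3 T3']] := ex_time vl n2 td L0.
have exj : exists j, (i <= j)%N && `[< k j = Balls12 >].
  have [j jn kj] : exists2 j, (n1 <= j < n2)%N & k j = Balls12.
    by apply: (ex_balls12 vl n12); lra.
  exists j; apply/andP; split; last by apply/asboolP.
  by case/andP: Ni => _ /ltnW h; apply: (leq_trans h); case/andP: jn.
have jn2 : (ex_minn exj < n2)%N.
  have [j jn kj] : exists2 j, (n1 <= j < n2)%N & k j = Balls12.
    by apply: (ex_balls12 vl n12); lra.
  case: ex_minnP => j0 _ /(_ j) h; case/andP: jn => n1j; apply: leq_ltn_trans.
  apply: h; apply/andP; split; last by apply/asboolP.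
  by case/andP: Ni => _ /ltnW h; apply: (leq_trans h).
move: jn2; case: ex_minnP => j /andP[ij /asboolP kj] jmin jn2.
have nk l : (i <= l < j)%N -> k l <> Balls12.
  move=> /andP[il lj] kl; have := jmin l; rewrite il /= => /(_ (asboolT kl)).
  by rewrite leqNgt lj.
have Nn2 : (N <= n2)%N := leq_trans Nn1 n12.
have Nn3 : (N <= n3)%N := leq_trans Nn2 n23.
have Tn4 : \sum_(n3 <= l < n3 + 4) t l <= 24 * V.
  apply: (@le_trans _ _ (\sum_(n3 <= l < n3 + 4) (6 * V))).
    by apply: ler_sum => l _; exact: (time_le vl).
  by rewrite sumr_const_nat addKn -mulr_natl; lra.
have Tn40 : 0 <= \sum_(n3 <= l < n3 + 4) t l.
  by apply: sumr_ge0 => l _; exact: (t_ge0 vl).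
have n34 : (n3 <= n3 + 4)%N by rewrite leq_addr.
have Tcat : \sum_(N <= l < n3 + 4) t l = \sum_(N <= l < n1) t l +
    \sum_(n1 <= l < n2) t l + \sum_(n2 <= l < n3) t l + \sum_(n3 <= l < n3 + 4) t l.
  by rewrite (big_cat_nat Nn3 n34) /= (big_cat_nat Nn2 n23) /= (big_cat_nat Nn1 n12).
exists (n3 + 4)%N; first exact: leq_trans Nn3 n34.
move=> eps e0 Qe.
have [l lN [l2 l3]] : exists2 l, (N <= l < n3 + 4)%N &
    `|y2 l| < (1 + 2 / Num.min a1 a2) * eps /\
    `|y3 l| < 3 * ((1 + 2 / Num.min a1 a2) * eps).
  apply: (eta_small _ e0) => //; first exact: leq_trans Nn3 n34.
  have := kick3_lb vl (leq_trans Nn3 n34).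
  set SJ := \sum_(N <= l < n3 + 4) J l => hJ.
  have : (4 * V + 1) / r <= SJ by rewrite /L in T3; lra.
  by rewrite ler_pdivrMr // (mulrC r).
have am0 : 0 < 1 + 2 / Num.min a1 a2.
  by apply: addr_gt0 => //; apply: divr_gt0 => //; rewrite lt_min A1 A2.
have ijN : (N <= i)%N by case/andP: Ni.
have jn4 : (j.+4 <= n3 + 4)%N by rewrite addn4 !ltnS; exact: ltnW (leq_trans jn2 n23).
have xj := xi_small ijN ij jn4 ki nk kj e0 Qe.
have TT : \sum_(N <= l < n3 + 4) t l <= T by rewrite Tcat /T; lra.
have jN : (N <= j <= n3 + 4)%N.
  by rewrite (leq_trans ijN ij) (leq_trans _ jn4) // -addn4 leq_addr.
have lN' : (N <= l <= n3 + 4)%N by case/andP: lN => -> /ltnW.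
have := nrm_drift jN lN' e0 TT Qe.
move=> nl; have {}nl : nrm l <= C1 * eps by apply: (le_trans nl); rewrite /C1; lra.
have C2e : 0 <= C2 * eps by apply: mulr_ge0; exact: ltW.
have C1e : 0 <= C1 * eps by apply: mulr_ge0; exact: ltW.
have Ce : (C1 + C2) * eps = C1 * eps + C2 * eps by ring.
have n1' := normr_ge0 (x2 l); have n2' := normr_ge0 (p * x3 l).
have n3' := normr_ge0 (x2 l - p * x3 l).
have y2e : `|y2 l| <= C2 * eps.
  apply: (le_trans (ltW l2)); rewrite /C2 ler_wpM2r ?(ltW e0) //; lra.
have y3e : `|y3 l| <= C2 * eps.
  by apply: (le_trans (ltW l3)); rewrite /C2 mulrA.
have x3e : `|x3 l| <= `|p * x3 l|.
  by rewrite normrM ler_peMl // ger0_norm ?(ltW p1) // (le_trans ler01 (ltW p1)).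
exists l => //; move: nl C1e C2e y2e y3e x3e n1' n2' n3'; rewrite /nrm Ce.
move: (C1 * eps) (C2 * eps) `|x2 l| `|p * x3 l| `|x2 l - p * x3 l|.
move: `|x3 l| `|y2 l| `|y3 l|; clear -vl tl am => *; split; lra.
Qed.

(** Each collision acts injectively, so a zero vector is traced back step by step. *)
Lemma tangent_zero i :
  [/\ x2 i = 0, x3 i = 0, y2 i = 0 & y3 i = 0] ->
  [/\ x2 0%N = 0, x3 0%N = 0, y2 0%N = 0 & y3 0%N = 0].
Proof.
elim: i => [//|i IH]; rewrite (x2S tl) (x3S tl) (y2S tl) (y3S tl).
case: (k i) => -[h1 h2 h3 h4]; apply: IH.
- by move: h3; rewrite h1 mulr0 addr0.
- have e2 : y2 i = 0 by apply/eqP; rewrite -oppr_eq0; apply/eqP.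
  move: h1 h4; rewrite h2 e2 !mulr0 addr0 subr0 add0r => /eqP.
  by rewrite oppr_eq0 => /eqP -> ->.
- have e3 : y3 i = 0 by apply/eqP; rewrite -oppr_eq0; apply/eqP.
  move: h2 h3; rewrite h1 e3 !mulr0 addr0 subr0 add0r => /eqP.
  by rewrite oppr_eq0 => /eqP -> ->.
Qed.

(** If [Qf] is bounded, its late gains are small and [window] applies. Either [Qf] is positive
    somewhere, and a vector of size O(eps) contradicts monotonicity, or [Qf] vanishes identically,
    and finitely many nonzero vectors would have to include arbitrarily small ones. *)
Lemma Qf_diverges : time_diverges t -> 0 <= Qf 0%N ->
  ~ [/\ x2 0%N = 0, x3 0%N = 0, y2 0%N = 0 & y3 0%N = 0] ->
  forall A, exists N, forall n, (N <= n)%N -> A <= Qf n.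
Proof.
move=> td Q0 w0 A; apply: contrapT => nb.
have QA n : Qf n <= A.
  rewrite leNgt; apply/negP => An; apply: nb; exists n => j nj.
  exact: le_trans (ltW An) (Qf_mono nj).
have [C C0 win] := window td.
have [[N0 QN0]|noQ] := pselect (exists N, 0 < Qf N).
  (* With this [eps], 2 C^2 eps^2 is at most half of [Qf N0]. *)
  pose eps := Num.min 1 (Qf N0 / (4 * C ^+ 2)).
  have C2 : 0 < 4 * C ^+ 2 by rewrite mulr_gt0 // exprn_gt0.
  have e0 : 0 < eps by rewrite lt_min ltr01 divr_gt0.
  have e1 : eps <= 1 by rewrite ge_min lexx.
  have e2 : 4 * C ^+ 2 * eps <= Qf N0.
    by rewrite mulrC -ler_pdivlMr // ge_min lexx orbT.
  have ee : 0 < eps ^+ 2 by rewrite exprn_gt0.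
  have [N1 tail] := tail_small ee Qf_mono QA.
  have [n Nn /(_ eps e0)] := win (maxn N0 N1).
  have h : Qf n - Qf (maxn N0 N1) <= eps ^+ 2 by apply: tail; rewrite leq_maxr.
  move=> /(_ h)[i /andP[Ni _] [X2 X3 Y2 Y3]].
  have Qi : Qf N0 <= Qf i.
    by apply: (Qf_mono); apply: leq_trans Ni; rewrite leq_maxl.
  have Qb : Qf i <= 2 * (C ^+ 2 * eps ^+ 2).
    rewrite /Qf.
    have b (x y : R) : `|x| <= C * eps -> `|y| <= C * eps -> x * y <= C ^+ 2 * eps ^+ 2.
      move=> hx hy; apply: (le_trans (ler_norm _)); rewrite normrM.
      have -> : C ^+ 2 * eps ^+ 2 = (C * eps) * (C * eps) by ring.
      exact: ler_pM.
    by have := b _ _ X2 Y2; have := b _ _ X3 Y3; lra.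
  have : C ^+ 2 * eps ^+ 2 <= C ^+ 2 * eps.
    by rewrite ler_pM2l ?exprn_gt0 // expr2 ler_piMl // ltW.
  lra.
have Qz n : Qf n = 0.
  apply/eqP; rewrite eq_le; apply/andP; split.
    by rewrite leNgt; apply/negP => h; apply: noQ; exists n.
  exact: le_trans Q0 (Qf_mono (leq0n n)).
(* There are no gains at all, so one and the same window serves every [eps]; [m] below is a lower
   bound for the sizes of its vectors. *)
have [n _ {}win] := win 0%N.
pose mu i := `|x2 i| + `|x3 i| + `|y2 i| + `|y3 i|.
have mu0 i : 0 < mu i.
  rewrite lt_neqAle eq_sym; apply/andP; split; last by rewrite !addr_ge0.
  apply/eqP => mz; apply: w0; apply: (@tangent_zero i).
  have := normr_ge0 (x2 i); have := normr_ge0 (x3 i).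
  have := normr_ge0 (y2 i); have := normr_ge0 (y3 i); move: mz; rewrite /mu => mz h1 h2 h3 h4.
  by split; apply/normr0_eq0; lra.
have [m m0 mm] : exists2 m, 0 < m & forall i, (i <= n)%N -> m <= mu i.
  elim: n {win} => [|n [m m0 IH]].
    by exists (mu 0%N) => // i; rewrite leqn0 => /eqP ->.
  exists (Num.min m (mu n.+1)); first by rewrite lt_min m0 mu0.
  move=> i; rewrite leq_eqVlt => /orP[/eqP ->|]; first by rewrite ge_min lexx orbT.
  by rewrite ltnS => /IH mi; rewrite ge_min mi.
have e0 : 0 < m / (8 * C) by rewrite divr_gt0 // mulr_gt0.
have [|i /andP[_ im] [X2 X3 Y2 Y3]] := win _ e0.
  by rewrite !Qz subrr sqr_ge0.
have := mm i im; rewrite /mu.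
have Ce : C * (m / (8 * C)) = m / 8 by field; rewrite gt_eqF.
by rewrite Ce in X2 X3 Y2 Y3; lra.
Qed.

End Tangent.

(** * Absence of accumulation of collisions *)

Section Zeno.
Context {R : realType}.
Variables (p r V : R) (k : nat -> wall) (v1 v2 v3 t : nat -> R).
Variables (m1 m2 m3 c : R) (q1 q2 q3 : nat -> R).
Hypothesis vl : velocity_law p r V k v1 v2 v3 t.
Local Notation F := (kick1 k v1).
Local Notation G := (kick2 k v1 v2).
Local Notation J := (kick3 k v2 v3).

Definition henergy (m v q : R) := m * v ^+ 2 / 2 + m * q.

Record position_law : Prop := PositionLaw {
  m1_gt0 : 0 < m1;
  m2_gt0 : 0 < m2;
  m3_gt0 : 0 < m3;
  c_gt0 : 0 < c;
  q1_ge0 : forall i, 0 <= q1 i;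
  q2_ge0 : forall i, 0 <= q2 i;
  q3_ge0 : forall i, 0 <= q3 i;
  q1_floor : forall i, k i = Floor -> q1 i = 0;
  q2_balls12 : forall i, k i = Balls12 -> q2 i = q1 i;
  q3_balls23 : forall i, k i = Balls23 -> q3 i = q2 i;
  q1_lip : forall i, `|q1 i.+1 - q1 i| <= V * t i;
  q2_lip : forall i, `|q2 i.+1 - q2 i| <= V * t i;
  q3_lip : forall i, `|q3 i.+1 - q3 i| <= V * t i;
  energyE : forall i, henergy m1 (v1 i) (q1 i) + henergy m2 (v2 i) (q2 i)
    + henergy m3 (v3 i) (q3 i) = c;
  h1S : forall i, k i <> Balls12 ->
    henergy m1 (v1 i.+1) (q1 i.+1) = henergy m1 (v1 i) (q1 i);
  h3S : forall i, k i <> Balls23 ->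
    henergy m3 (v3 i.+1) (q3 i.+1) = henergy m3 (v3 i) (q3 i) }.

Hypothesis pl : position_law.

Lemma henergy_ge0 m v q : 0 < m -> 0 <= q -> 0 <= henergy m v q.
Proof.
move=> m0 q0; rewrite /henergy addr_ge0 //.
  by apply: divr_ge0 => //; apply: mulr_ge0; [exact: ltW|exact: sqr_ge0].
by apply: mulr_ge0 => //; exact: ltW.
Qed.

(** The bounds on [v] and [q] are those that [tail_energy] reaches for ball 3, the weakest of the
    three; 41 rounds up 81 / 2, and d^2 is at most d. *)
Lemma henergy_small m v q d : 0 < m -> 0 <= V -> 0 < d -> d <= 1 ->
  `|v| <= 9 * d -> q <= 3 * (V * d) -> henergy m v q <= m * (41 + 3 * V) * d.
Proof.
move=> m0 V0 d0 d1 vd qd.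
have vv : v ^+ 2 <= 81 * d.
  have : v ^+ 2 <= (9 * d) ^+ 2.
    rewrite -(real_normK (num_real v)) lerXn2r // nnegrE //; lra.
  by nra.
rewrite /henergy.
have h1 : m * v ^+ 2 <= m * (81 * d) by rewrite ler_pM2l.
have h2 : m * q <= m * (3 * (V * d)) by rewrite ler_pM2l.
have h3 : 0 < m * d by rewrite mulr_gt0.
lra.
Qed.

Lemma lip_sum (f : nat -> R) (g : nat -> R) i j : (i <= j)%N ->
  (forall l, `|f l.+1 - f l| <= g l) -> `|f j - f i| <= \sum_(i <= l < j) g l.
Proof.
move=> ij fg; rewrite -telescope_sumr //; apply: (le_trans (ler_norm_sum _ _ _)).
by apply: ler_sum.
Qed.

Let total i := t i + F i + G i + J i.

Lemma total_ge0 i : 0 <= total i.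
Proof.
have := t_ge0 vl i; have := kick1_ge0 vl i; have := kick2_ge0 vl i.
by have := kick3_ge0 vl i; rewrite /total; lra.
Qed.

Definition infinitely w := forall N, exists2 i, (N <= i)%N & k i = w.

Lemma infinitely_floor : infinitely Floor.
Proof.
by move=> N; have [j _ kj] := floor_within4 vl N; exists (N + j)%N => //; exact: leq_addr.
Qed.

Section Bounded.
Variable T : R.
Hypothesis tT : forall n, \sum_(0 <= i < n) t i <= T.

Lemma tail_total d : 0 < d -> exists N, forall i j, (N <= i <= j)%N ->
  \sum_(i <= l < j) total l <= d.
Proof.
move=> d0; pose f n := \sum_(0 <= l < n) total l.
have fm : {homo f : i j / (i <= j)%N >-> i <= j}.
  move=> i j ij; rewrite /f (big_cat_nat (leq0n i) ij) /= lerDl.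
  by apply: sumr_ge0 => l _; exact: total_ge0.
(* The bound adds up [T] and the three estimates 3 T + 6 V, 2 T + 4 V and T + 2 V of the kicks. *)
have [n|N NP] := @tail_small _ f (7 * T + 12 * V) d d0 fm.
  rewrite /f /total !big_split /=.
  have := kick1_ub vl (leq0n n); have := kick2_ub vl (leq0n n).
  by have := kick3_ub vl (leq0n n); have := tT n; lra.
exists N => i j Nij; have := NP i j Nij; rewrite /f.
case/andP: Nij => _ ij; rewrite (big_cat_nat (leq0n i) ij) /=; lra.
Qed.

(** Late velocities and positions vary by O(d) only, and each kick is at most d. Ball 1 is thus low
    and slow because it hits the floor; this passes to ball 2 at a collision 12 and to ball 3 at a
    collision 23, adding [3 * d] to the speed and [V * d] to the height each time. *)
Lemma tail_energy d : 0 < d -> d <= 1 -> exists N,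
  [/\ forall j, (N <= j)%N -> henergy m1 (v1 j) (q1 j) <= m1 * (41 + 3 * V) * d,
      infinitely Balls12 -> forall j, (N <= j)%N ->
        henergy m2 (v2 j) (q2 j) <= m2 * (41 + 3 * V) * d &
      infinitely Balls12 -> infinitely Balls23 -> forall j, (N <= j)%N ->
        henergy m3 (v3 j) (q3 j) <= m3 * (41 + 3 * V) * d].
Proof.
move=> d0 d1; have V0 := V_ge0 vl; have [N NP] := tail_total d0.
have [_ p1 p2 r0 r1 t0 _ _ _ e1 e2 e3 _ _ _] := vl.
have tot i : (N <= i)%N -> total i <= d.
  by move=> Ni; have := NP i i.+1; rewrite Ni leqnSn big_nat1 => /(_ isT).
have tail2 (f : nat -> R) (C : R) : 0 <= C ->
    (forall l, `|f l.+1 - f l| <= C * total l) ->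
    forall i j, (N <= i)%N -> (N <= j)%N -> `|f j - f i| <= C * d.
  move=> C0 fg; have aux i j : (N <= i <= j)%N -> `|f j - f i| <= C * d.
    move=> Nij; case/andP: (Nij) => _ ij; apply: (le_trans (lip_sum ij fg)).
    by rewrite -mulr_sumr ler_wpM2l //; exact: NP.
  move=> i j Ni Nj; have [ij|/ltnW ij] := leqP i j; first by apply: aux; rewrite Ni.
  by rewrite distrC; apply: aux; rewrite Nj.
have F0 := kick1_ge0 vl; have G0 := kick2_ge0 vl; have J0 := kick3_ge0 vl.
have dv1 := @tail2 v1 2 ltac:(lra).
have {}dv1 : forall i j, (N <= i)%N -> (N <= j)%N -> `|v1 j - v1 i| <= 2 * d.
  apply: dv1 => l; have := F0 l; have := G0 l; have := J0 l; have := t0 l.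
  rewrite e1 /total; move: (F l) (G l) (J l) (t l) => F' G' J' t' h1 h2 h3 h4.
  have h5 : 0 <= (2 - p) * G' by apply: mulr_ge0; lra.
  have h6 : 0 <= (p - 1) * G' by apply: mulr_ge0; lra.
  by rewrite ler_norml; apply/andP; split; lra.
have dv2 := @tail2 v2 2 ltac:(lra).
have {}dv2 : forall i j, (N <= i)%N -> (N <= j)%N -> `|v2 j - v2 i| <= 2 * d.
  apply: dv2 => l; have := F0 l; have := G0 l; have := J0 l; have := t0 l.
  rewrite e2 /total; move: (F l) (G l) (J l) (t l) => F' G' J' t' h1 h2 h3 h4.
  have h5 : 0 <= (2 - p) * G' by apply: mulr_ge0; lra.
  have h6 : 0 <= (p - 1) * G' by apply: mulr_ge0; lra.
  have h7 : 0 <= (1 - r) * J' by apply: mulr_ge0; lra.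
  have h8 : 0 <= r * J' by apply: mulr_ge0; lra.
  by rewrite ler_norml; apply/andP; split; lra.
have dv3 := @tail2 v3 2 ltac:(lra).
have {}dv3 : forall i j, (N <= i)%N -> (N <= j)%N -> `|v3 j - v3 i| <= 2 * d.
  apply: dv3 => l; have := F0 l; have := G0 l; have := J0 l; have := t0 l.
  rewrite e3 /total; move: (F l) (G l) (J l) (t l) => F' G' J' t' h1 h2 h3 h4.
  have h7 : 0 <= (1 - r) * J' by apply: mulr_ge0; lra.
  have h8 : 0 <= r * J' by apply: mulr_ge0; lra.
  by rewrite ler_norml; apply/andP; split; lra.
have tl l : V * t l <= V * total l.
  by rewrite ler_wpM2l // /total; have := F0 l; have := G0 l; have := J0 l; lra.
have dq1 := tail2 q1 V V0 (fun l => le_trans (q1_lip pl l) (tl l)).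
have dq2 := tail2 q2 V V0 (fun l => le_trans (q2_lip pl l) (tl l)).
have dq3 := tail2 q3 V V0 (fun l => le_trans (q3_lip pl l) (tl l)).
have Vd : 0 <= V * d by rewrite mulr_ge0 // ltW.
have kl l : (N <= l)%N -> [/\ F l <= d, G l <= d & J l <= d].
  move=> /tot; rewrite /total; have := F0 l; have := G0 l; have := J0 l.
  by have := t0 l => *; split; lra.
have s1 j : (N <= j)%N -> `|v1 j| <= 3 * d /\ q1 j <= V * d.
  move=> Nj; have [i Ni ki] := infinitely_floor N.
  have [Fd _ _] := kl _ Ni; have := v1_lt0 vl ki; rewrite /kick1 ki in Fd.
  have := dv1 _ _ Ni Nj; have := dq1 _ _ Ni Nj; rewrite (q1_floor pl ki).
  by rewrite !ler_norml; split; lra.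
have s2 : infinitely Balls12 -> forall j, (N <= j)%N ->
    `|v2 j| <= 6 * d /\ q2 j <= 2 * (V * d).
  move=> inf j Nj; have [i Ni ki] := inf N; have [+ q1i] := s1 i Ni.
  have [_ Gd _] := kl _ Ni; have := v2_lt_v1 vl ki; rewrite /kick2 ki in Gd.
  have := dv2 _ _ Ni Nj; have := dq2 _ _ Ni Nj; rewrite (q2_balls12 pl ki).
  by rewrite !ler_norml; split; lra.
exists N; split.
- move=> j Nj; have [v1j q1j] := s1 j Nj.
  by apply: henergy_small => //; [exact: m1_gt0 pl|lra|lra].
- move=> inf j Nj; have [v2j q2j] := s2 inf j Nj.
  by apply: henergy_small => //; [exact: m2_gt0 pl|lra|lra].
- move=> inf inf' j Nj; have [i Ni ki] := inf' N; have [v2i q2i] := s2 inf i Ni.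
  have [_ _ Jd] := kl _ Ni; have := v3_lt_v2 vl ki; rewrite /kick3 ki in Jd.
  have := dv3 _ _ Ni Nj; have := dq3 _ _ Ni Nj; rewrite (q3_balls23 pl ki).
  rewrite !ler_norml in v2i *; move=> hq hv hlt.
  apply: henergy_small => //; [exact: m3_gt0 pl| |lra].
  by rewrite ler_norml; lra.
Qed.

Lemma iter_const (f : nat -> R) w N : (forall i, k i <> w -> f i.+1 = f i) ->
  (forall i, (N <= i)%N -> k i <> w) -> forall i j, (N <= i <= j)%N -> f j = f i.
Proof.
move=> fS nw i j /andP[Ni]; elim: j => [|j IH]; first by rewrite leqn0 => /eqP ->.
rewrite leq_eqVlt => /orP[/eqP -> //|]; rewrite ltnS => ij.
by rewrite fS ?IH //; apply: nw; exact: leq_trans ij.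
Qed.

Lemma not_infinitely w : ~ infinitely w ->
  exists N, forall i, (N <= i)%N -> k i <> w.
Proof.
move=> nw; apply: contrapT => h; apply: nw => N; apply: contrapT => h'.
by apply: h; exists N => i Ni ki; apply: h'; exists i.
Qed.

(* In a finite total time the kicks are summable.  Hence after some step a ball
   has small energy if it hits the floor, or a ball of small energy, infinitely
   often.  The conservation of the total energy, of that of balls 1 and 2
   (between collisions 23) or of that of ball 1 (between collisions 12) forbids
   this. *)
Lemma bounded_time_false : False.
Proof.
have V0 := V_ge0 vl.
have [M1 M2 M3 c0 q1p q2p q3p _ _ _ _ _ _ En _ _] := pl.
set K := (m1 + m2 + m3) * (41 + 3 * V).
have K0 : 0 < K by apply: mulr_gt0; lra.
have pick x : 0 < x -> exists d, [/\ 0 < d, d <= 1 & K * d < x].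
  move=> x0; exists (Num.min 1 (x / (2 * K))); split.
  - by rewrite lt_min ltr01 divr_gt0 // mulr_gt0.
  - by rewrite ge_min lexx.
  have K20 : 0 < 2 * K by lra.
  have : Num.min 1 (x / (2 * K)) <= x / (2 * K) by rewrite ge_min lexx orbT.
  rewrite ler_pdivlMr //; lra.
have Kd d (x y z : R) : 0 < d -> x <= m1 * (41 + 3 * V) * d -> y <= m2 * (41 + 3 * V) * d ->
    z <= m3 * (41 + 3 * V) * d -> x + y + z <= K * d.
  by rewrite /K; lra.
have md d m : 0 < d -> 0 < m -> 0 <= m * (41 + 3 * V) * d.
  by move=> d0 m0; apply: mulr_ge0; [apply: mulr_ge0; lra|lra].
have fl N : exists2 i, (N <= i)%N & 0 < henergy m1 (v1 i) (q1 i).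
  have [i Ni ki] := infinitely_floor N; exists i => //.
  rewrite /henergy (q1_floor pl ki) mulr0 addr0 divr_gt0 // mulr_gt0 //.
  by rewrite lt_def sqr_ge0 andbT sqrf_eq0 lt_eqF // (v1_lt0 vl ki).
have [inf2|/not_infinitely[N0 no2]] := pselect (infinitely Balls12); last first.
  have [i Ni hi] := fl N0; have [d [d0 d1 dK]] := pick _ hi.
  have [N [h1 _ _]] := tail_energy d0 d1.
  have := h1 (maxn N i) (leq_maxl _ _).
  rewrite (@iter_const (fun j => henergy m1 (v1 j) (q1 j)) Balls12 N0 (h1S pl) no2 i).
    by move=> hh; have := Kd _ _ _ _ d0 hh (md _ _ d0 M2) (md _ _ d0 M3); lra.
  by rewrite Ni leq_maxr.
have [inf3|/not_infinitely[N0 no3]] := pselect (infinitely Balls23); last first.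
  have [i Ni hi] := fl N0; have [d [d0 d1 dK]] := pick _ hi.
  have [N [h1 h2 _]] := tail_energy d0 d1.
  have e1 := h1 (maxn N i) (leq_maxl _ _).
  have e2 := h2 inf2 (maxn N i) (leq_maxl _ _).
  have := @iter_const (fun j => henergy m3 (v3 j) (q3 j)) Balls23 N0 (h3S pl) no3 i (maxn N i).
  rewrite Ni leq_maxr => /(_ isT) e3.
  have := Kd _ _ _ _ d0 e1 e2 (md _ _ d0 M3).
  have := En (maxn N i); have := En i; rewrite e3.
  have := henergy_ge0 (v2 i) M2 (q2p i); lra.
have [d [d0 d1 dK]] := pick _ c0.
have [N [h1 h2 h3]] := tail_energy d0 d1.
have := Kd _ _ _ _ d0 (h1 N (leqnn N)) (h2 inf2 N (leqnn N)) (h3 inf2 inf3 N (leqnn N)).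
by have := En N; lra.
Qed.

End Bounded.

Lemma time_diverges_of_energy : time_diverges t.
Proof.
move=> N A; apply: contrapT => h.
apply: (@bounded_time_false (\sum_(0 <= i < N) t i + `|A|)) => n.
have [Nn|/ltnW nN] := leqP N n.
  rewrite (big_cat_nat (leq0n N) Nn) /= lerD2l; apply: le_trans (ler_norm A).
  by rewrite leNgt; apply/negP => /ltW hA; apply: h; exists n.
rewrite (big_cat_nat (leq0n n) nN) /= -addrA lerDl addr_ge0 //.
by apply: sumr_ge0 => i _; exact: (t_ge0 vl).
Qed.

End Zeno.

(** * Free motion, collision laws and reversal of momenta *)

Lemma ord3P (P : 'I_3 -> Prop) : P b1 -> P b2 -> P b3 -> forall i, P i.
Proof.
move=> P1 P2 P3 [[|[|[|//]]] hi].
- by rewrite (_ : Ordinal hi = b1) //; apply: val_inj.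
- by rewrite (_ : Ordinal hi = b2) //; apply: val_inj.
- by rewrite (_ : Ordinal hi = b3) //; apply: val_inj.
Qed.

Lemma sum3E (R : realType) (f : 'I_3 -> R) : \sum_(i < 3) f i = f b1 + f b2 + f b3.
Proof.
rewrite !big_ord_recr big_ord0 /= add0r.
by congr (_ + _ + _); congr f; apply: val_inj.
Qed.

Lemma col3_b1 (R : realType) (x y z : R) : col3 x y z b1 ord0 = x.
Proof. by rewrite mxE. Qed.
Lemma col3_b2 (R : realType) (x y z : R) : col3 x y z b2 ord0 = y.
Proof. by rewrite mxE. Qed.
Lemma col3_b3 (R : realType) (x y z : R) : col3 x y z b3 ord0 = z.
Proof. by rewrite mxE. Qed.
Definition col3E := (col3_b1, col3_b2, col3_b3).

Section Mechanics.
Context {R : realType}.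
Variables (m : 'I_3 -> R) (c : R).
Hypothesis m_gt0 : forall i, 0 < m i.

Lemma m_neq0 i : m i != 0. Proof. by rewrite gt_eqF. Qed.
Let m12_neq0 : m b1 + m b2 != 0. Proof. by rewrite gt_eqF // addr_gt0. Qed.
Let m23_neq0 : m b2 + m b3 != 0. Proof. by rewrite gt_eqF // addr_gt0. Qed.

Lemma pos_flow t (x : phase R) i :
  pos (flow m t x) i = pos x i + vel m x i * t - t ^+ 2 / 2.
Proof. by rewrite /pos mxE. Qed.

Lemma vel_flow t (x : phase R) i : vel m (flow m t x) i = vel m x i - t.
Proof. by rewrite /vel /mom mxE mulrBl mulrAC divff ?m_neq0 // mul1r. Qed.

Lemma flow0 (x : phase R) : flow m 0 x = x.
Proof.
case: x => q p'; congr (_, _); apply/matrixP => i j; rewrite !mxE (ord1 j) /pos /mom /=.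
  by rewrite mulr0 expr2 !mul0r; ring.
by rewrite mulr0 subr0.
Qed.

Lemma flowD s t (x : phase R) : flow m s (flow m t x) = flow m (t + s) x.
Proof.
congr (_, _); apply/matrixP => i j; rewrite !mxE ?pos_flow ?vel_flow.
  by field.
by rewrite /mom mxE; rewrite /mom; ring.
Qed.

Lemma energyE' (x : phase R) i : energy m x i = henergy (m i) (vel m x i) (pos x i).
Proof. by rewrite /energy /henergy /vel; field; rewrite m_neq0. Qed.

Lemma HE (x : phase R) : H m x = henergy (m b1) (vel m x b1) (pos x b1)
  + henergy (m b2) (vel m x b2) (pos x b2) + henergy (m b3) (vel m x b3) (pos x b3).
Proof. by rewrite /H sum3E !energyE'. Qed.

Lemma henergy_flow t (x : phase R) i :
  henergy (m i) (vel m (flow m t x) i) (pos (flow m t x) i) =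
  henergy (m i) (vel m x i) (pos x i).
Proof. by rewrite pos_flow vel_flow /henergy; field. Qed.

Lemma H_flow t (x : phase R) : H m (flow m t x) = H m x.
Proof. by rewrite !HE !henergy_flow. Qed.

Lemma pos_Phi k (x : phase R) i : pos (Phi m k x) i = pos x i.
Proof. by []. Qed.

Definition velPhi k (x : phase R) : 'I_3 -> R := fun i =>
  match k with
  | Floor => col3 (- vel m x b1) (vel m x b2) (vel m x b3) i ord0
  | Balls12 => let g := gamma m b1 b2 in
      col3 (g * vel m x b1 + (1 - g) * vel m x b2)
        ((1 + g) * vel m x b1 - g * vel m x b2) (vel m x b3) i ord0
  | Balls23 => let g := gamma m b2 b3 in
      col3 (vel m x b1) (g * vel m x b2 + (1 - g) * vel m x b3)
        ((1 + g) * vel m x b2 - g * vel m x b3) i ord0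
  end.

Lemma vel_Phi k (x : phase R) i : vel m (Phi m k x) i = velPhi k x i.
Proof.
rewrite {1}/vel /mom /Phi /velPhi; move: i; apply: ord3P; case: k => /=;
  rewrite !col3E // mulrC mulKf ?m_neq0 //.
Qed.

Lemma H_Phi k (x : phase R) : H m (Phi m k x) = H m x.
Proof.
rewrite !HE !pos_Phi !vel_Phi /velPhi /henergy /gamma.
case: k => /=; rewrite !col3E; field.
- by [].
- by rewrite m12_neq0.
- by rewrite m23_neq0.
Qed.

Lemma PhiK k (x : phase R) : Phi m k (Phi m k x) = x.
Proof.
have e i : mom (Phi m k (Phi m k x)) i = mom x i.
  have -> : mom x i = m i * vel m x i by rewrite /vel mulrC divfK ?m_neq0.
  have -> : mom (Phi m k (Phi m k x)) i = m i * vel m (Phi m k (Phi m k x)) i.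
    by rewrite /vel mulrC divfK ?m_neq0.
  congr (_ * _); rewrite vel_Phi {1}/velPhi !vel_Phi /velPhi /gamma.
  move: i; apply: ord3P; case: k => /=; rewrite !col3E //; rewrite ?opprK //; field;
    by rewrite ?m12_neq0 ?m23_neq0.
rewrite [LHS]surjective_pairing [RHS]surjective_pairing; congr (_, _).
by apply/matrixP => i j; rewrite (ord1 j); exact: e.
Qed.

Lemma Dom_Phi k (x : phase R) : Dom m c x -> Dom m c (Phi m k x).
Proof. by case=> Hx qx; split => //; rewrite H_Phi. Qed.

(* Positive right before the collision k, negative right after it. *)
Definition rvel k (x : phase R) : R :=
  match k with
  | Floor => - vel m x b1
  | Balls12 => vel m x b1 - vel m x b2
  | Balls23 => vel m x b2 - vel m x b3
  end.

Definition gap k (x : phase R) : R :=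
  match k with
  | Floor => pos x b1
  | Balls12 => pos x b2 - pos x b1
  | Balls23 => pos x b3 - pos x b2
  end.

Lemma MmP k (x : phase R) : Mm m c k x <-> [/\ Dom m c x, gap k x = 0 & 0 < rvel k x].
Proof.
rewrite /Mm /gap /rvel; case: k; split.
- by case=> Dx [q0 v0]; split => //; rewrite oppr_gt0.
- by case=> Dx q0; rewrite oppr_gt0.
- by case=> Dx [q0 v0]; split => //; [rewrite q0 subrr|rewrite subr_gt0].
- by case=> Dx /eqP; rewrite subr_eq0 => /eqP e; rewrite subr_gt0; split.
- by case=> Dx [q0 v0]; split => //; [rewrite q0 subrr|rewrite subr_gt0].
- by case=> Dx /eqP; rewrite subr_eq0 => /eqP e; rewrite subr_gt0; split.
Qed.

Lemma MpP k (x : phase R) : Mp m c k x <-> [/\ Dom m c x, gap k x = 0 & rvel k x <= 0].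
Proof.
rewrite /Mp /gap /rvel; case: k; split.
- by case=> Dx [q0 v0]; split => //; rewrite oppr_le0.
- by case=> Dx q0; rewrite oppr_le0.
- by case=> Dx [q0 v0]; split => //; [rewrite q0 subrr|rewrite subr_le0].
- by case=> Dx /eqP; rewrite subr_eq0 => /eqP e; rewrite subr_le0; split.
- by case=> Dx [q0 v0]; split => //; [rewrite q0 subrr|rewrite subr_le0].
- by case=> Dx /eqP; rewrite subr_eq0 => /eqP e; rewrite subr_le0; split.
Qed.

Lemma rvel_Phi k (x : phase R) : rvel k (Phi m k x) = - rvel k x.
Proof. by case: k; rewrite /rvel !vel_Phi /velPhi !col3E //; ring. Qed.

Lemma gap_Phi k l (x : phase R) : gap k (Phi m l x) = gap k x.
Proof. by []. Qed.

Lemma DomP (x : phase R) : Dom m c x <-> H m x = c /\ forall k, 0 <= gap k x.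
Proof.
split=> [[Hx [h1 h2 h3]]|[Hx hg]]; split=> //.
  by case; rewrite /gap ?subr_ge0.
by split; [exact: hg Floor|have := hg Balls12|have := hg Balls23]; rewrite /gap ?subr_ge0.
Qed.

(** By [flow_flip] and [Phi_flip] this reversal turns backward branches into forward ones. *)
Definition flip (x : phase R) : phase R := (x.1, - x.2).

Lemma vel_flip (x : phase R) i : vel m (flip x) i = - vel m x i.
Proof. by rewrite /vel /mom mxE mulNr. Qed.

Lemma pos_flip (x : phase R) i : pos (flip x) i = pos x i.
Proof. by []. Qed.

Lemma flipK (x : phase R) : flip (flip x) = x.
Proof. by case: x => a b; rewrite /flip /= opprK. Qed.

Lemma H_flip (x : phase R) : H m (flip x) = H m x.
Proof. by rewrite !HE !vel_flip !pos_flip /henergy !sqrrN. Qed.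

Lemma Dom_flip (x : phase R) : Dom m c x -> Dom m c (flip x).
Proof. by case=> Hx qx; split => //; rewrite H_flip. Qed.

Lemma rvel_flip k (x : phase R) : rvel k (flip x) = - rvel k x.
Proof. by case: k; rewrite /rvel !vel_flip //; ring. Qed.

Lemma phase_eq (x y : phase R) :
  (forall i, pos x i = pos y i) -> (forall i, vel m x i = vel m y i) -> x = y.
Proof.
case: x => q p; case: y => q' p' hq hp; congr (_, _); apply/matrixP => i j;
  rewrite (ord1 j); first exact: hq.
by apply: (mulIf (invr_neq0 (m_neq0 i))); exact: hp.
Qed.

Lemma flow_flip t (x : phase R) : flow m t (flip (flow m t x)) = flip x.
Proof.
apply: phase_eq => i.
  by rewrite !pos_flow !vel_flip !pos_flip pos_flow vel_flow; field.
by rewrite vel_flow !vel_flip vel_flow; ring.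
Qed.

Lemma Phi_flip k (x : phase R) : Phi m k (flip x) = flip (Phi m k x).
Proof.
apply: phase_eq => // i; rewrite vel_flip !vel_Phi /velPhi !vel_flip.
by move: i; apply: ord3P; case: k => /=; rewrite !col3E //; ring.
Qed.

End Mechanics.

(** * From orbits in phase space to the laws for velocities, tangent vectors and positions *)

Section Orbits.
Context {R : realType}.
Variables (m : 'I_3 -> R) (c : R).

(* z i is the state right before the collision k i, and t i the time until the
   next one. *)
Record trajectory (z : nat -> phase R) (k : nat -> wall) (t : nat -> R) : Prop := Trajectory {
  orbit_Mm : forall i, Mm m c (k i) (z i);
  orbit_time : forall i, 0 <= t i;
  orbitS : forall i, z i.+1 = flow m (t i) (Phi m (k i) (z i)) }.

Hypotheses (h12 : m b2 < m b1) (h23 : m b3 <= m b2) (h3 : 0 < m b3).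
Hypothesis hm : 2 * Num.sqrt (m b1) * Num.sqrt (m b3) =
  Num.sqrt (m b1 + m b2) * Num.sqrt (m b2 + m b3).
Hypothesis hc : 0 < c.

Lemma mass_gt0 i : 0 < m i.
Proof. by move: i; apply: ord3P => //; [apply: lt_trans h12|]; apply: lt_le_trans h23. Qed.

Let M1 : 0 < m b1 := mass_gt0 b1.
Let M2 : 0 < m b2 := mass_gt0 b2.

Lemma mass_relation : 4 * m b1 * m b3 = (m b1 + m b2) * (m b2 + m b3).
Proof.
have := congr1 (fun x => x ^+ 2) hm; rewrite /= !exprMn !sqr_sqrtr; last 4 first.
- by rewrite addr_ge0 // ltW.
- by rewrite addr_ge0 // ltW.
- exact: ltW.
- exact: ltW.
by move=> <-; ring.
Qed.

(** If m_2 = m_3, the mass condition becomes m_1 = m_2. Strictness makes alpha_2 positive and r <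
    1. *)
Lemma m3_lt_m2 : m b3 < m b2.
Proof.
rewrite lt_def h23 andbT; apply/eqP => e.
have := mass_relation; rewrite -e => e4.
have : (m b1 - m b2) * m b2 = 0 by lra.
by move=> /eqP; rewrite mulf_eq0 gt_eqF ?subr_gt0 // gt_eqF.
Qed.

Let p := 1 + gamma m b1 b2.
Let r := 1 - gamma m b2 b3.
(** The energy bounds v^2 by 2 c / m_3, and |v| is at most 1 + v^2. *)
Let V := 1 + 2 * c / m b3.

Let m12 : 0 < m b1 + m b2. Proof. exact: addr_gt0. Qed.
Let m23 : 0 < m b2 + m b3. Proof. exact: addr_gt0. Qed.

Let pE : p = 2 * m b1 / (m b1 + m b2).
Proof. by rewrite /p /gamma; field; rewrite gt_eqF. Qed.
Let rE : r = 2 * m b3 / (m b2 + m b3).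
Proof. by rewrite /r /gamma; field; rewrite gt_eqF. Qed.

Let prE : p * r = 1.
Proof.
rewrite pE rE mulf_div.
have -> : 2 * m b1 * (2 * m b3) = 4 * m b1 * m b3 by ring.
by rewrite mass_relation divff // gt_eqF // mulr_gt0.
Qed.

Let V_gt0 : 0 < V.
Proof. by rewrite /V addr_gt0 // divr_gt0 // mulr_gt0. Qed.

Lemma energy_le x i : Dom m c x -> energy m x i <= c.
Proof.
move=> [Hx [p1 p2 p3]].
have q j : 0 <= pos x j by move: j; apply: ord3P; lra.
have e j : 0 <= energy m x j.
  by rewrite energyE'; [apply: henergy_ge0 => //; exact: mass_gt0|exact: mass_gt0].
move: Hx; rewrite /H sum3E; have := e b1; have := e b2; have := e b3.
by move: i; apply: ord3P; lra.
Qed.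

Lemma vel_le x i : Dom m c x -> `|vel m x i| <= V.
Proof.
move=> Dx; have mi := mass_gt0 i.
have qi : 0 <= pos x i.
  by case: Dx => _ [p1 p2 p3]; move: i mi; apply: ord3P => _; lra.
have := energy_le i Dx; rewrite (energyE' mass_gt0) /henergy => h.
have h3i : m b3 <= m i.
    by move: (i); apply: ord3P; [exact: ltW (le_lt_trans h23 h12)|exact: h23|exact: lexx].
have v2 : vel m x i ^+ 2 <= 2 * c / m b3.
  rewrite ler_pdivlMr //.
  have : m b3 * vel m x i ^+ 2 <= m i * vel m x i ^+ 2 by rewrite ler_wpM2r ?sqr_ge0.
  have : 0 <= m i * pos x i by rewrite mulr_ge0 // ltW.
  lra.
have : `|vel m x i| <= 1 + vel m x i ^+ 2.
  rewrite -(real_normK (num_real (vel m x i))); move: `|_| (normr_ge0 (vel m x i)) => y y0.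
  by have := sqr_ge0 (y - 1); nra.
by rewrite /V; lra.
Qed.

Section Orbit.
Variables (z : nat -> phase R) (k : nat -> wall) (t : nat -> R).
Hypothesis orb : trajectory z k t.
Let v j i := vel m (z i) j.
Let q j i := pos (z i) j.

Let Dz i : Dom m c (z i).
Proof. by case: (orbit_Mm orb i). Qed.

Let vS j i : v j i.+1 = velPhi m (k i) (z i) j - t i.
Proof. by rewrite /v (orbitS orb) vel_flow ?vel_Phi //; exact: mass_gt0. Qed.

Let relz i : 0 < rvel m (k i) (z i).
Proof. by have /MmP[] := orbit_Mm orb i. Qed.

Let gapz i : gap (k i) (z i) = 0.
Proof. by have /MmP[] := orbit_Mm orb i. Qed.

Lemma orbit_velocity : velocity_law p r V k (v b1) (v b2) (v b3) t.
Proof.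
split.
- exact: prE.
- by have := h12; rewrite pE ltr_pdivlMr //; lra.
- by rewrite pE ltr_pdivrMr //; have := M2; lra.
- by rewrite rE divr_gt0 // mulr_gt0.
- by have := m3_lt_m2; rewrite rE ltr_pdivrMr //; lra.
- exact: orbit_time orb.
- by move=> i ki; have := relz i; rewrite /rvel ki oppr_gt0.
- by move=> i ki; have := relz i; rewrite /rvel ki subr_gt0.
- by move=> i ki; have := relz i; rewrite /rvel ki subr_gt0.
- by move=> i; rewrite vS /velPhi /kick1 /kick2; case: (k i); rewrite col3E /p /v; ring.
- by move=> i; rewrite vS /velPhi /kick3 /kick2; case: (k i); rewrite col3E /p /r /v; ring.
- by move=> i; rewrite vS /velPhi /kick3; case: (k i); rewrite col3E /r /v; ring.
- by move=> i; exact: vel_le.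
- by move=> i; exact: vel_le.
- by move=> i; exact: vel_le.
Qed.

(** The mean velocity of a free fall is the average of the initial and final ones, both bounded by
    [V]. *)
Let q_lip j i : `|q j i.+1 - q j i| <= V * t i.
Proof.
have D1 := Dom_Phi mass_gt0 (k i) (Dz i).
have v1 := vel_le j D1; have v2 := vel_le j (Dz i.+1).
rewrite (orbitS orb) vel_flow in v2; last exact: mass_gt0.
rewrite /q (orbitS orb) pos_flow pos_Phi.
have -> : pos (z i) j + vel m (Phi m (k i) (z i)) j * t i - t i ^+ 2 / 2 - pos (z i) j
    = (vel m (Phi m (k i) (z i)) j + (vel m (Phi m (k i) (z i)) j - t i)) / 2 * t i.
  by field.
have t0 := orbit_time orb i.
rewrite normrM (ger0_norm t0) ler_wpM2r //.
by move: v1 v2; rewrite !ler_norml; lra.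
Qed.

Let hS j i : velPhi m (k i) (z i) j = v j i ->
  henergy (m j) (v j i.+1) (q j i.+1) = henergy (m j) (v j i) (q j i).
Proof.
move=> e; rewrite /v /q (orbitS orb) henergy_flow ?vel_Phi ?e //; exact: mass_gt0.
Qed.

Lemma orbit_position : position_law V k (v b1) (v b2) (v b3) t
  (m b1) (m b2) (m b3) c (q b1) (q b2) (q b3).
Proof.
have q0 i : [/\ 0 <= q b1 i, 0 <= q b2 i & 0 <= q b3 i].
  by have [_ [p1 p2 p3]] := Dz i; rewrite /q; split; lra.
split=> //.
- by move=> i; case: (q0 i).
- by move=> i; case: (q0 i).
- by move=> i; case: (q0 i).
- by move=> i ki; have := gapz i; rewrite /gap ki.
- by move=> i ki; have := gapz i; rewrite /gap ki => /eqP; rewrite subr_eq0 => /eqP.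
- by move=> i ki; have := gapz i; rewrite /gap ki => /eqP; rewrite subr_eq0 => /eqP.
- by move=> i; rewrite -HE ?(proj1 (Dz i)) //; exact: mass_gt0.
- move=> i ki; case E: (k i) (ki) => // _.
    by rewrite /v /q (orbitS orb) henergy_flow ?vel_Phi /velPhi ?E ?col3E /henergy ?sqrrN //; exact: mass_gt0.
  by apply: hS; rewrite /velPhi E col3E.
- by move=> i ki; apply: hS; rewrite /velPhi; case E: (k i) ki => // _; rewrite col3E.
Qed.

Variable w : nat -> tvec R.
Hypothesis wS : forall i, w i.+1 = dPhi m (k i) (z i) (w i).

Let a1 := 2 * m b1 * m b2 * (m b1 - m b2) / (m b1 + m b2) ^+ 2.
Let a2 := 2 * m b2 * m b3 * (m b2 - m b3) / (m b2 + m b3) ^+ 2.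
Let b0 := 2 / (m b1 * V).
(** The value away from the floor is a placeholder that makes [B_ge] hold at every step. *)
Let B i := if k i is Floor then beta m (z i) else b0.

Lemma orbit_tangent : tangent_law p r k (v b1) (v b2) (v b3) a1 a2 b0 B
  (fun i => (w i).1 b2 ord0) (fun i => (w i).1 b3 ord0)
  (fun i => (w i).2 b2 ord0) (fun i => (w i).2 b3 ord0).
Proof.
split.
- by rewrite divr_gt0 ?exprn_gt0 // !mulr_gt0 // subr_gt0.
- by rewrite divr_gt0 ?exprn_gt0 // !mulr_gt0 // subr_gt0 m3_lt_m2.
- by rewrite divr_gt0 // mulr_gt0.
- move=> i; rewrite /B; case E: (k i) => //.
  have := relz i; rewrite E /rvel => v0.
  have := vel_le b1 (Dz i); rewrite ler_norml => /andP[vV _].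
  rewrite /beta /b0 -mulrN -invrN -mulrN ler_pM2l // lef_pV2 ?posrE ?mulr_gt0 //.
  by rewrite ler_pM2l //; lra.
- move=> i; rewrite wS /dPhi /kick2 /v; case: (k i); rewrite /= ?col3E // /alpha /a1 /p.
  by ring.
- move=> i; rewrite wS /dPhi /kick3 /v; case: (k i); rewrite /= ?col3E // /alpha /a2 /r.
  by ring.
- move=> i; rewrite wS /dPhi /B; case E: (k i); rewrite /= ?col3E //.
- move=> i; rewrite wS /dPhi /B; case E: (k i); rewrite /= ?col3E //.
Qed.

Lemma w_L12 : L12 (w 0%N) -> forall i, L12 (w i).
Proof.
move=> w0; elim=> // i [e1 e2]; rewrite wS.
by split; rewrite /dPhi; case: (k i); rewrite /= ?col3E.
Qed.

Lemma Q_L12 (u : tvec R) : L12 u ->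
  Q u = u.1 b2 ord0 * u.2 b2 ord0 + u.1 b3 ord0 * u.2 b3 ord0.
Proof. by move=> [e1 e2]; rewrite /Q sum3E e1 mul0r add0r. Qed.

Lemma Q_diverges : L12 (w 0%N) -> 0 <= Q (w 0%N) -> w 0%N <> 0 ->
  forall A, exists N, forall n, (N <= n)%N -> A <= Q (w n).
Proof.
move=> wL Q0 w0 A.
have td := time_diverges_of_energy orbit_velocity orbit_position.
have [||N NP] := Qf_diverges orbit_velocity orbit_tangent td _ _ A.
- by rewrite /Qf -Q_L12.
- move=> [e1 e2 e3 e4]; apply: w0; case: wL => f1 f2.
  rewrite [LHS]surjective_pairing -[(w 0%N).1]col3_eta -[(w 0%N).2]col3_eta.
  rewrite e1 e2 e3 e4 f1 f2; congr (_, _);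
  by apply/matrixP => i j; rewrite !mxE; case: i => [[|[|[|]]]].
by exists N => n Nn; rewrite Q_L12; [exact: NP|exact: w_L12].
Qed.

End Orbit.

End Orbits.

(** * Existence of the next and the previous collision, and time reversal *)

Section Hitting.
Context {R : realType}.
Variables (m : 'I_3 -> R) (c : R).
Hypothesis m_gt0 : forall i, 0 < m i.

Lemma gap_flow k s (x : phase R) : gap k (flow m s x) =
  gap k x - rvel m k x * s - (if k is Floor then s ^+ 2 / 2 else 0).
Proof. by case: k; rewrite /gap /rvel !pos_flow; ring. Qed.

Lemma rvel_flow k s (x : phase R) : rvel m k (flow m s x) =
  rvel m k x + (if k is Floor then s else 0).
Proof. by case: k; rewrite /rvel !(vel_flow m_gt0); ring. Qed.

(** In [Mminus] some gap is zero and closing, hence negative at every later time. A flow line thus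
    meets [Mminus] at most once, and the infimum in [tau] is taken over at most one point. *)
Lemma Mminus_flow_unique s t (x : phase R) :
  Mminus m c (flow m s x) -> Mminus m c (flow m t x) -> s = t.
Proof.
have aux s' t' : s' < t' -> Mminus m c (flow m s' x) -> Mminus m c (flow m t' x) -> False.
  move=> st [k /MmP[_ g0 v0]] [l /MmP[/DomP[_ /(_ k)] + _ _]].
  have -> : flow m t' x = flow m (t' - s') (flow m s' x).
    by rewrite (flowD m_gt0); congr flow; ring.
  rewrite gap_flow g0 sub0r => h.
  have : 0 < rvel m k (flow m s' x) * (t' - s') by rewrite mulr_gt0 // subr_gt0.
  by have := sqr_ge0 (t' - s'); case: k {g0 v0} h => /=; lra.
move=> hs ht; case: (ltgtP s t) => // st; exfalso.
  exact: aux st hs ht.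
exact: aux st ht hs.
Qed.

Lemma tau_ge0 (x : phase R) : 0 <= tau m c x.
Proof.
rewrite /tau; set A := [set t | _].
have [->|A0] := eqVneq A set0; first by rewrite inf0.
by apply: lb_le_inf; [exact/set0P|move=> t []].
Qed.

Lemma hitE t (x : phase R) : 0 <= t -> Mminus m c (flow m t x) ->
  hit m c x = flow m t x.
Proof.
move=> t0 ht; rewrite /hit /tau (_ : [set _ | _] = [set t]) ?inf1 //.
apply/seteqP; split=> [s [_ hs]|s ->] //=.
exact: Mminus_flow_unique hs ht.
Qed.

(** The collision is the earliest among the impact of ball 1 on the floor and the closing times of
    the two other gaps. *)
Lemma ex_hit (x : phase R) : Dom m c x ->
  0 < gap Floor x \/ rvel m Floor x < 0 ->
  exists2 t, 0 <= t & Mminus m c (flow m t x).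
Proof.
move=> /DomP[Hx gx] h0.
have q0 := gx Floor.
set q := gap Floor x in h0 q0; set v := rvel m Floor x in h0.
(* Ball 1 alone would reach the floor at time [d - v] with speed [d], and [h0] makes [d]
   positive. *)
set d := Num.sqrt (v ^+ 2 + 2 * q).
have dd : d ^+ 2 = v ^+ 2 + 2 * q by rewrite sqr_sqrtr // addr_ge0 ?sqr_ge0 // mulr_ge0.
have d0 : 0 <= d by exact: sqrtr_ge0.
have vd : `|v| <= d.
  by rewrite -ler_sqr ?nnegrE // real_normK ?num_real // dd; lra.
have dpos : 0 < d.
  rewrite lt_neqAle d0 andbT eq_sym; apply/eqP => dz; move: dd h0; rewrite dz.
  have := sqr_ge0 v; move=> v2 dd [q1|v1]; first by lra.
  have : 0 < v ^+ 2 by rewrite lt_def sqr_ge0 andbT sqrf_eq0 lt_eqF.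
  lra.
pose tF := d - v.
have tF0 : 0 <= tF by rewrite /tF; move: vd; rewrite ler_norml; lra.
(* A gap that is not closing receives the floor time [tF]; if the minimum is attained there, the
   collision is with the floor. *)
pose tk k := if 0 < rvel m k x then gap k x / rvel m k x else tF.
have tk0 k : 0 <= tk k.
  by rewrite /tk; case: ifP => // vk; apply: divr_ge0 => //; exact: ltW.
pose T := Num.min tF (Num.min (tk Balls12) (tk Balls23)).
have T0 : 0 <= T by rewrite !le_min tF0 !tk0.
have T1 : T <= tF by rewrite ge_min lexx.
have T2 : T <= tk Balls12 by rewrite !ge_min lexx orbT.
have T3 : T <= tk Balls23 by rewrite !ge_min lexx !orbT.
have gk k : T <= tk k -> 0 <= gap k x - rvel m k x * T.
  rewrite /tk; case: ifP => [vk|/negbT]; first by rewrite ler_pdivlMr //; lra.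
  rewrite -leNgt => vk _; have : 0 <= - rvel m k x * T by rewrite mulr_ge0 // oppr_ge0.
  by have := gx k; lra.
have gF : 0 <= q - v * T - T ^+ 2 / 2.
  have -> : q - v * T - T ^+ 2 / 2 = (tF - T) * (T + (d + v)) / 2.
    have -> : q = (d ^+ 2 - v ^+ 2) / 2 by rewrite dd; field.
    by rewrite /tF; field.
  apply: divr_ge0 => //; apply: mulr_ge0; first by rewrite subr_ge0.
  by move: vd; rewrite ler_norml; lra.
have DT : Dom m c (flow m T x).
  apply/DomP; split; first by rewrite H_flow.
  case; rewrite gap_flow //; first by rewrite subr0; exact: gk.
  by rewrite subr0; exact: gk.
exists T => //.
have atF : T = tF -> Mm m c Floor (flow m T x).
  move=> TF; apply/MmP; split => //; rewrite ?gap_flow ?rvel_flow.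
    rewrite -/q -/v TF.
    have -> : q = (d ^+ 2 - v ^+ 2) / 2 by rewrite dd; field.
    by rewrite /tF; field.
  by rewrite -/v TF /tF; lra.
have atk k : k <> Floor -> T = tk k -> Mminus m c (flow m T x).
  move=> kF; rewrite /tk; case: ifP => [vk Tk|_ TF]; last by exists Floor; exact: atF.
  exists k; apply/MmP; split => //; rewrite ?gap_flow ?rvel_flow Tk.
    by case: k kF vk {Tk} => // _ vk; rewrite subr0 mulrC divfK ?subrr // gt_eqF.
  by case: k kF vk {Tk} => // _ vk; rewrite addr0.
have [TF|TF] := leP tF (Num.min (tk Balls12) (tk Balls23)).
  by exists Floor; apply: atF; rewrite /T; apply/min_idPl.
have Te : T = Num.min (tk Balls12) (tk Balls23) by rewrite /T; apply/min_idPr; exact: ltW.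
have [t12|t12] := leP (tk Balls12) (tk Balls23).
  by apply: (@atk Balls12) => //; rewrite Te; apply/min_idPl.
by apply: (@atk Balls23) => //; rewrite Te; apply/min_idPr; exact: ltW.
Qed.

Lemma Mm_Phi k (x : phase R) : Mm m c k x -> Mp m c k (Phi m k x).
Proof.
move=> /MmP[Dx g0 v0]; apply/MpP; split => //; first exact: Dom_Phi.
by rewrite rvel_Phi // oppr_le0 ltW.
Qed.

(* The states with a tangential contact that a branch may reach; they are the
   only ones at which T or its inverse may be undefined. *)
Definition tangential (x : phase R) : Prop :=
  [\/ gap Balls12 x = 0 /\ rvel m Balls12 x = 0,
      gap Balls23 x = 0 /\ rvel m Balls23 x = 0 |
      [/\ gap Floor x = 0, rvel m Floor x = 0 &
          gap Balls12 x = 0 \/ gap Balls23 x = 0]].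

Lemma step_exists (x : phase R) : Mplus m c x ->
  (gap Floor x = 0 -> rvel m Floor x = 0 -> tangential x) -> ~ tangential x ->
  exists l y, step m c l x y.
Proof.
move=> Mx Ex nEx.
have Dx : Dom m c x by case: Mx => k /MpP[].
suff [t t0 ht] : exists2 t, 0 <= t & Mminus m c (flow m t x).
  have e := hitE t0 ht; case: ht => l hl.
  by exists l, (Phi m l (hit m c x)); split => //; rewrite e.
have /DomP[_ /(_ Floor) q0] := Dx.
have [q1|q1] := ltP 0 (gap Floor x); first by apply: ex_hit => //; left.
have {q0 q1} qz : gap Floor x = 0 by lra.
have [v0|v0|v0] := ltgtP (rvel m Floor x) 0.
- by apply: ex_hit => //; right.
- by exists 0 => //; rewrite flow0 //; exists Floor; apply/MmP.
- by exfalso; exact: nEx (Ex qz v0).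
Qed.

(** The last collision is undone by the involution [Phi], which gives a state [z]. Either [z] has
    just left the floor and is itself the preimage in [Mplus], or the orbit is followed backward by
    applying [ex_hit] to [flip z]. *)
Lemma step_preimage_exists (x : phase R) : Mplus m c x -> Mminus m c (hit m c x) ->
  ~ tangential x -> exists l y, step m c l y x.
Proof.
move=> [k0 Mx0] hx nEx.
have [k Dx [gk vk]] : exists2 k, Dom m c x & gap k x = 0 /\ rvel m k x < 0.
  have /MpP[Dx g0] := Mx0; rewrite le_eqVlt => /orP[/eqP v0|v0]; last by exists k0.
  exfalso; apply: nEx; case: k0 {Mx0} g0 v0 => g0 v0; last 2 first.
  - by constructor 1.
  - by constructor 2.
  (* Ball 1 rests on the floor and would be below it at any positive time. The hitting time is
     therefore 0, and a collision of balls is due at [x] itself. *)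
  case: (hx) => l /MmP[/DomP[_ /(_ Floor)]].
  rewrite {1}/hit gap_flow g0 v0 mul0r subr0 sub0r => ht.
  have t0 : tau m c x = 0.
    apply/eqP; rewrite -sqrf_eq0 eq_le sqr_ge0 andbT; lra.
  rewrite /hit t0 flow0 // => gl vl; constructor 3; split => //.
  by case: l gl vl => gl vl; [move: vl; rewrite v0 ltxx|left|right].
have Mz : Mm m c k (Phi m k x).
  by apply/MmP; split => //; [exact: Dom_Phi|rewrite rvel_Phi // oppr_gt0].
set z := Phi m k x in Mz.
have zx : x = Phi m k z by rewrite /z PhiK.
have Dz : Dom m c z by case/MmP: Mz.
suff [y My [t t0 yz]] : exists2 y, Mplus m c y & exists2 t, 0 <= t & flow m t y = z.
  exists k, y; have e : hit m c y = z by rewrite -yz; apply: hitE => //; rewrite yz; exists k.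
  by split => //; rewrite e.
have [q1|q1] := ltP 0 (gap Floor z); last first.
  have /DomP[_ /(_ Floor) q0] := Dz; have qz : gap Floor z = 0 by lra.
  have [v0|v0] := leP (rvel m Floor z) 0.
    exists z; first by exists Floor; apply/MpP.
    by exists 0 => //; rewrite flow0.
  have [t t0 [l /MmP[Dt gt vt]]] : exists2 t, 0 <= t & Mminus m c (flow m t (flip z)).
    by apply: ex_hit; [exact: Dom_flip|right; rewrite rvel_flip oppr_lt0].
  exists (flip (flow m t (flip z))).
    exists l; apply/MpP; split => //; first exact: Dom_flip.
    by rewrite rvel_flip oppr_le0 ltW.
  by exists t => //; rewrite flow_flip // flipK.
have [t t0 [l /MmP[Dt gt vt]]] : exists2 t, 0 <= t & Mminus m c (flow m t (flip z)).
  by apply: ex_hit; [exact: Dom_flip|left].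
exists (flip (flow m t (flip z))).
  exists l; apply/MpP; split => //; first exact: Dom_flip.
  by rewrite rvel_flip oppr_le0 ltW.
by exists t => //; rewrite flow_flip // flipK.
Qed.

(** When ball 1 rests on the floor, a second contact is present: at the start by definition of
    [Sminus], later because the last collision was not the floor one, after which ball 1 moves
    upwards. *)
Lemma fdefined_or_tangential (x : phase R) : Sminus m c x -> ~ fdefined m c x ->
  exists n s k, fbranch m c n x s k /\ tangential (s n).
Proof.
move=> Sx; apply: contra_notP => nE n s k b.
have [s0 st] := b.
have M12 : Mp m c Balls12 x by case: Sx => -[[]].
have nT : ~ tangential (s n) by move=> T; apply: nE; exists n, s, k.
apply: step_exists => //.
  case: n b st nT => [|n] b st _; first by rewrite s0; exists Balls12.
  have [_ hn ->] := st n (ltnSn n); exists (k n); exact: Mm_Phi.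
move=> g0 v0; constructor 3; split=> //.
case: n b st nT g0 v0 => [|n] b st _ g0 v0.
  by left; rewrite s0; case/MpP: M12.
have [_ hn e] := st n (ltnSn n); rewrite e gap_Phi -[gap Balls23 _]/(gap Balls23 (hit m c (s n))).
case/MmP: hn; case E: (k n) => [] _ gn vn; [|by left|by right].
by move: v0; rewrite e E rvel_Phi //; lra.
Qed.

Lemma bdefined_or_tangential (x : phase R) : Splus m c x -> ~ bdefined m c x ->
  exists n s k, bbranch m c n x s k /\ tangential (s n).
Proof.
move=> Sx; apply: contra_notP => nE n s k b.
have [s0 st] := b.
have nT : ~ tangential (s n) by move=> T; apply: nE; exists n, s, k.
apply: step_preimage_exists => //.
  case: n b st nT => [|n] b st _.
    by rewrite s0; case: Sx => -[Mx _]; [exists Floor|exists Balls23].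
  by have [] := st n (ltnSn n).
case: n b st nT => [|n] b st _.
  by rewrite s0; case: Sx => -[_ [Mx _]]; [exists Balls12|exists Floor].
by have [_ hn _] := st n (ltnSn n); exists (k n).
Qed.

Lemma fbranch_orbit x s k : (forall n, fbranch m c n x s k) ->
  trajectory m c (fun i => hit m c (s i)) k (fun i => tau m c (s i.+1)).
Proof.
move=> b; have st i : step m c (k i) (s i) (s i.+1).
  by have [_] := b i.+1; apply.
split=> i.
- by case: (st i).
- exact: tau_ge0.
- by have [_ _ e] := st i; rewrite -e.
Qed.

(** With momenta reversed, the state [s i] right after the collision [k i] becomes one right before
    it. *)
Lemma bbranch_orbit x s k : (forall n, bbranch m c n x s k) ->
  trajectory m c (fun i => flip (s i)) k (fun i => tau m c (s i.+1)).
Proof.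
move=> b; have st i : step m c (k i) (s i.+1) (s i).
  by have [_] := b i.+1; apply.
split=> i.
- have [_ /MmP[D g v] ->] := st i; apply/MmP; split => //.
    by apply: (Dom_flip m_gt0); exact: (Dom_Phi m_gt0).
  by rewrite rvel_flip rvel_Phi // opprK.
- exact: tau_ge0.
- have [_ _ e] := st i.
  by rewrite {1}e Phi_flip // PhiK // /hit flow_flip.
Qed.

(** The tangent action of [flip]: energies are even in the momenta and velocities odd. It changes
    the sign of Q and so exchanges the two cones. *)
Definition trev (w : tvec R) : tvec R := (w.1, - w.2).

Lemma Q_trev w : Q (trev w) = - Q w.
Proof. by rewrite /Q !sum3E /= !mxE; ring. Qed.

Lemma trevK w : trev (trev w) = w.
Proof. by case: w => a b; rewrite /trev /= opprK. Qed.

(** [beta] depends only on the velocity of ball 1, and the alphas only on the relative velocity of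
    the colliding balls. *)
Lemma dPhi_trev k (x y : phase R) w :
  (k = Floor -> vel m y b1 = vel m x b1) ->
  (k <> Floor -> rvel m k y = rvel m k x) ->
  trev (dPhiV m k x w) = dPhi m k y (trev w).
Proof.
move=> hF hk; rewrite /trev /dPhi /dPhiV; case: k hF hk => [/(_ erefl) hF _|_ hk|_ hk] /=.
- congr (_, _); rewrite /beta hF.
  by apply/matrixP => i j; move: i; apply: ord3P; rewrite !mxE /=; ring.
- have {hk} := hk ltac:(by []); rewrite /rvel /alpha => ->; congr (_, _);
  by apply/matrixP => i j; move: i; apply: ord3P; rewrite !mxE /=; ring.
- have {hk} := hk ltac:(by []); rewrite /rvel /alpha => ->; congr (_, _);
  by apply/matrixP => i j; move: i; apply: ord3P; rewrite !mxE /=; ring.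
Qed.

Lemma dTVn_trev x s k w i : (forall n, bbranch m c n x s k) ->
  trev (dTVn m c s k i.+1 w) = dPhi m (k i) (flip (s i)) (trev (dTVn m c s k i w)).
Proof.
move=> b; have st : step m c (k i) (s i.+1) (s i).
  by have [_] := b i.+1; apply.
have [_ hm' e] := st; apply: dPhi_trev => [kF|kF].
  by rewrite vel_flip e kF vel_Phi // /velPhi col3E opprK.
by rewrite rvel_flip {1}e rvel_Phi // opprK.
Qed.

End Hitting.

(** * Sets of zero Hausdorff measure *)

Section RowNorm.
Context {R : realType} {n : nat}.
Implicit Types (x : 'rV[R]_n.+1) (r : R).

Lemma row_coord_le x i : `|x ord0 i| <= `|x|.
Proof. by rewrite [leRHS]mx_normrE; exact: (le_bigmax _ (fun ij => `|x ij.1 ij.2|) (ord0, i)). Qed.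

Lemma row_norm_le x r : 0 <= r -> (forall i, `|x ord0 i| <= r) -> `|x| <= r.
Proof.
by move=> r0 h; rewrite [leLHS]mx_normrE; apply: bigmax_le => // -[i j] _ /=; rewrite (ord1 i).
Qed.

End RowNorm.

(* Sets of zero d-dimensional Hausdorff measure; no bound on the diameters is
   required, since a small sum of powers forces small diameters. *)
Definition hnull (R : realType) (n d : nat) (A : set 'rV[R]_n.+1) : Prop :=
  forall eps : R, 0 < eps -> exists (F : nat -> set 'rV[R]_n.+1) (r : nat -> R),
    [/\ forall k, 0 <= r k,
        forall k x y, F k x -> F k y -> `|x - y| <= r k,
        A `<=` \bigcup_k F k &
        forall N, \sum_(0 <= k < N) r k ^+ d <= eps].

Section Hnull.
Context {R : realType}.

Lemma diam_le n (A : set 'rV[R]_n.+1) (r : R) : 0 <= r ->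
  (forall x y, A x -> A y -> `|x - y| <= r) -> (diam A <= r%:E)%E.
Proof.
move=> r0 h; rewrite /diam ge_max lee_fin r0 /=.
by apply: ge_ereal_sup => _ [x [y [Ax Ay ->]]]; rewrite lee_fin; exact: h.
Qed.

Lemma diam_ge0 n (A : set 'rV[R]_n.+1) : (0 <= diam A)%E.
Proof. by rewrite /diam le_max lexx. Qed.

Lemma diam_exp_le n d (A : set 'rV[R]_n.+1) (r : R) : 0 <= r -> (diam A <= r%:E)%E ->
  (diam A ^+ d <= (r ^+ d)%:E)%E.
Proof.
move=> r0; have := diam_ge0 A; case: (diam A) => [x| |] //.
by rewrite lee_fin -EFin_expe !lee_fin => x0 xr; rewrite lerXn2r // nnegrE.
Qed.

Lemma hnull_hausdorff n d (A : set 'rV[R]_n.+1) : (0 < d)%N -> hnull d A ->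
  hausdorff d A = 0%E.
Proof.
move=> d0 A0; have pre_ge0 delta : (0 <= hausdorff_pre d delta A)%E.
  apply: le_ereal_inf_tmp => _ [F [_ _ ->]]; apply: nneseries_ge0 => k _ _.
  by apply: expe_ge0; exact: diam_ge0.
have pre0 delta : 0 < delta -> hausdorff_pre d delta A = 0%E.
  move=> delta0; apply/eqP; rewrite eq_le pre_ge0 andbT.
  apply/lee_addgt0Pr => eps eps0; rewrite add0e.
  (* The bound delta^d on the sum bounds every single term, so that each [r k] is at most
     [delta]. *)
  have e0 : 0 < Num.min eps (delta ^+ d) by rewrite lt_min eps0 exprn_gt0.
  have [F [r [r0 Fr AF sr]]] := A0 _ e0.
  have rdelta k : r k <= delta.
    rewrite -(@ler_pXn2r _ d) ?nnegrE ?(ltW delta0) //.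
    have h : r k ^+ d <= Num.min eps (delta ^+ d).
      apply: le_trans (sr k.+1); rewrite big_nat_recr //= lerDr.
      by apply: sumr_ge0 => i _; exact: exprn_ge0.
    by apply: (le_trans h); rewrite ge_min lexx orbT.
  have dF k : (diam (F k) <= (r k)%:E)%E by apply: diam_le => //; exact: Fr.
  apply: (@le_trans _ _ (\sum_(0 <= k <oo) (diam (F k) ^+ d))%E).
    apply: ereal_inf_lbound; exists F; split => // k.
    by apply: (le_trans (dF k)); rewrite lee_fin.
  apply: lime_le.
    by apply: is_cvg_nneseries => k _ _; apply: expe_ge0; exact: diam_ge0.
  apply: nearW => N.
  apply: (@le_trans _ _ (\sum_(0 <= k < N) (r k ^+ d)%:E)%E).
    by apply: lee_sum => k _; exact: diam_exp_le.
  by rewrite sumEFin lee_fin; apply: (le_trans (sr N)); rewrite ge_min lexx.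
apply/eqP; rewrite eq_le; apply/andP; split.
  by apply: ge_ereal_sup => _ [delta /= delta0 <-]; rewrite pre0.
by apply: ereal_sup_ubound; exists 1 => /=; [exact: ltr01|exact: pre0].
Qed.

Lemma hnull_sub n d (A B : set 'rV[R]_n.+1) : A `<=` B -> hnull d B -> hnull d A.
Proof.
move=> AB B0 eps e0; have [F [r [r0 Fr BF sr]]] := B0 eps e0.
by exists F, r; split => //; exact: subset_trans BF.
Qed.

Lemma sum_half (eps : R) K : \sum_(0 <= j < K) eps / 2 ^+ j.+1 = eps - eps / 2 ^+ K.
Proof.
elim: K => [|K IH]; first by rewrite big_geq // expr0 divr1 subrr.
by rewrite big_nat_recr //= IH exprS invfM; set w := (2 ^+ K)^-1; field.
Qed.

(** Finitely many codes of pairs lie in a square [K] by [K], over which the double sum is at most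
    [eps]. *)
Lemma sum_pickle (u : nat -> nat -> R) (eps : R) N :
  (forall j i, 0 <= u j i) -> (forall K L, \sum_(0 <= j < K) \sum_(0 <= i < L) u j i <= eps) ->
  \sum_(0 <= k < N) (if pickle_inv k is Some ji then u ji.1 ji.2 else 0) <= eps.
Proof.
move=> u0 ue.
have [K KP] : exists K, forall k ji, (k < N)%N -> pickle_inv k = Some ji ->
    (ji.1 < K)%N /\ (ji.2 < K)%N.
  elim: N => [|N [K IH]]; first by exists 0%N.
  case E : (pickle_inv N : option (nat * nat)) => [[a b]|].
    exists (maxn K (maxn a b).+1) => k ji; rewrite ltnS leq_eqVlt => /orP[/eqP ->|kN].
      by rewrite E => -[<-] /=; split; rewrite leq_max ltnS ?leq_maxl ?leq_maxr orbT.
    by move=> /(IH _ _ kN)[h1 h2]; split; rewrite leq_max ?h1 ?h2.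
  exists K => k ji; rewrite ltnS leq_eqVlt => /orP[/eqP ->|kN]; first by rewrite E.
  exact: IH.
apply: le_trans (ue K K).
(* Each term is spread over the square by an indicator; after the sums are exchanged, every pair is
   counted at most once. *)
have -> : \sum_(0 <= k < N) (if pickle_inv k is Some ji then u ji.1 ji.2 else 0) =
    \sum_(0 <= k < N) \sum_(0 <= j < K) \sum_(0 <= i < K)
      (if pickle (j, i) == k then u j i else 0).
  rewrite [LHS]big_nat [RHS]big_nat; apply: eq_bigr => k /= kN.
  case E : (pickle_inv k : option (nat * nat)) => [[a b]|].
    have [aK bK] := KP _ _ kN E; rewrite /= in aK bK.
    have pk : pickle (a, b) = k by have := @pickle_invK (nat * nat)%type k; rewrite E.
    rewrite !big_mkord (bigD1 (Ordinal aK)) //= !big_mkord (bigD1 (Ordinal bK)) //= pk eqxx.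
    rewrite big1 ?addr0 ?big1 ?addr0 // => [j ja|i ib].
      rewrite big_mkord big1 // => i _; case: eqP => // e; exfalso.
      have : (nat_of_ord j, nat_of_ord i) = (a, b) by apply: (pcan_inj pickleK); rewrite e.
      by case=> e1 _; move: ja => /eqP; apply; apply: val_inj.
    case: eqP => // e; exfalso.
    have : (a, nat_of_ord i) = (a, b) by apply: (pcan_inj pickleK); rewrite e.
    by case=> e1; move: ib => /eqP; apply; apply: val_inj.
  rewrite big1 // => j _; rewrite big1 // => i _; case: eqP => // e.
  by move: E; rewrite -e pickleK_inv.
rewrite exchange_big /=; apply: ler_sum => j _.
rewrite exchange_big /=; apply: ler_sum => i _.
rewrite -big_mkcond /=.
have [kN|kN] := ltnP (pickle (j, i)) N; last first.
  rewrite big_nat_cond big1 // => k /andP[/andP[_ kN'] /eqP e].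
  by rewrite -e ltnNge kN in kN'.
by rewrite big_mkord (big_pred1 (Ordinal kN)).
Qed.

Lemma hnull_bigcup n d (A : nat -> set 'rV[R]_n.+1) : (0 < d)%N ->
  (forall j, hnull d (A j)) -> hnull d (\bigcup_j A j).
Proof.
move=> d0 A0 eps e0.
have ej j : 0 < eps / 2 ^+ j.+1 by rewrite divr_gt0 // exprn_gt0.
have [F FP] := choice (fun j => A0 j _ (ej j)).
have [r rP] := choice FP.
exists (fun k => if pickle_inv k is Some ji then F ji.1 ji.2 else set0).
exists (fun k => if pickle_inv k is Some ji then r ji.1 ji.2 else 0); split.
- by move=> k; case: pickle_inv => // -[j i]; case: (rP j).
- by move=> k x y; case: pickle_inv => // -[j i] /=; case: (rP j) => _ + _ _; apply.
- move=> x [j _ Ajx]; have [_ _ /(_ x Ajx)[i _ Fx] _] := rP j.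
  by exists (pickle (j, i)) => //=; rewrite pickleK_inv.
- move=> N; have r0 j i : 0 <= r j i by case: (rP j).
  have -> : \sum_(0 <= k < N)
      (if pickle_inv k is Some ji then r ji.1 ji.2 else 0) ^+ d =
    \sum_(0 <= k < N) (if pickle_inv k is Some ji then r ji.1 ji.2 ^+ d else 0).
    by apply: eq_bigr => k _; case: pickle_inv => //; rewrite expr0n gtn_eqF.
  apply: (sum_pickle (u := fun j i => r j i ^+ d)) => [j i|K L]; first exact: exprn_ge0.
  apply: (@le_trans _ _ (\sum_(0 <= j < K) eps / 2 ^+ j.+1)).
    by apply: ler_sum => j _; case: (rP j).
  by rewrite sum_half lerBlDr lerDl divr_ge0 ?exprn_ge0 // ltW.
Qed.

Lemma hnull_lipschitz n n' d (A : set 'rV[R]_n.+1) (f : 'rV[R]_n.+1 -> 'rV[R]_n'.+1)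
    (L : R) : 0 <= L -> (forall x y, A x -> A y -> `|f x - f y| <= L * `|x - y|) ->
  hnull d A -> hnull d (f @` A).
Proof.
move=> L0 fL A0 eps e0.
(* The summand 1 covers the case [L = 0]. *)
have L1 : 0 < L ^+ d + 1 by rewrite ltr_wpDl ?exprn_ge0.
have e0' : 0 < eps / (L ^+ d + 1) by rewrite divr_gt0.
have [F [r [r0 Fr AF sr]]] := A0 _ e0'.
exists (fun k => f @` (A `&` F k)), (fun k => L * r k); split.
- by move=> k; rewrite mulr_ge0.
- move=> k _ _ [x [Ax Fx] <-] [y [Ay Fy] <-]; apply: le_trans (fL _ _ Ax Ay) _.
  by rewrite ler_wpM2l //; exact: Fr.
- by move=> _ [x Ax <-]; have [k _ Fk] := AF _ Ax; exists k => //; exists x.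
- move=> N; have -> : \sum_(0 <= k < N) (L * r k) ^+ d = L ^+ d * \sum_(0 <= k < N) r k ^+ d.
    by rewrite mulr_sumr; apply: eq_bigr => k _; rewrite exprMn.
  apply: (@le_trans _ _ (L ^+ d * (eps / (L ^+ d + 1)))).
    by rewrite ler_wpM2l ?exprn_ge0.
  rewrite mulrA ler_pdivrMr // mulrC ler_pM2l //; lra.
Qed.

Lemma sum_const_bounded (x : R) B N : 0 <= x ->
  \sum_(0 <= k < N) (if (k < B)%N then x else 0) <= B%:R * x.
Proof.
move=> x0; suff -> : \sum_(0 <= k < N) (if (k < B)%N then x else 0) = (minn N B)%:R * x.
  by rewrite ler_wpM2r // ler_nat geq_minr.
elim: N => [|N IH]; first by rewrite big_geq // min0n mul0r.
rewrite big_nat_recr //= IH; case: ltnP => NB.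
  by rewrite (minn_idPl NB) -[N.+1]addn1 natrD mulrDl mul1r.
by rewrite addr0 (minn_idPr (leqW NB)).
Qed.

Lemma grid_cell (u : R) N : (0 < N)%N -> 0 <= u -> u <= 1 ->
  exists2 a, (a < N)%N & a%:R / N%:R <= u <= a.+1%:R / N%:R.
Proof.
move=> N0 u0 u1; have N0' : (0 : R) < N%:R by rewrite ltr0n.
pose P b := u * N%:R <= b.+1%:R.
have PN : P N.-1 by rewrite /P prednK // ler_piMl // ltW.
have exP : exists b, P b by exists N.-1.
case: (ex_minnP exP) => a Pa amin; exists a.
  by rewrite -[X in (_ < X)%N](prednK N0) ltnS; exact: amin.
apply/andP; split; last by rewrite ler_pdivlMr.
rewrite ler_pdivrMr //; case: a Pa amin => [|a] Pa amin; first by rewrite mulr_ge0 // ltW.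
have : ~~ P a by apply/negP => /amin; rewrite ltnn.
by rewrite /P -ltNge => /ltW.
Qed.

Let box (M : R) := [set x : 'rV[R]_2 | `|x| <= M].

(** A square of side C is cut into N^2 squares of side C / N, whose cubed sides add up to C^3 /
    N. *)
Lemma hnull_box M : 0 <= M -> hnull 3 (box M).
Proof.
move=> M0 eps e0; set C := 2 * M.
have [N N0 NC] : exists2 N, (0 < N)%N & C ^+ 3 <= eps * N%:R.
  exists (Num.truncn (C ^+ 3 / eps)).+1 => //.
  by rewrite mulrC -ler_pdivrMr // ltW // truncnS_gt.
have N0' : (0 : R) < N%:R by rewrite ltr0n.
pose cell a : set R := [set s | a%:R / N%:R <= (s + M) / (2 * M) <= a.+1%:R / N%:R /\ `|s| <= M].
pose F k := if (k < N * N)%N then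
    [set x : 'rV[R]_2 | forall i : 'I_2,
        cell (if i == ord0 then k %/ N else k %% N)%N (x ord0 i)] else set0.
have C0 : 0 <= C by rewrite mulr_ge0.
exists F, (fun k => if (k < N * N)%N then C / N%:R else 0); split.
- by move=> k; case: ifP => // _; apply: divr_ge0 => //; exact: ltW.
- move=> k x y; rewrite /F; case: ifP => // _ Fx Fy.
  apply: row_norm_le; first by apply: divr_ge0 => //; exact: ltW.
  move=> i; rewrite !mxE; move: (Fx i) (Fy i); rewrite /cell /=.
  move: (if i == ord0 then _ else _) => a [/andP[x1 x2] xM] [/andP[y1 y2] yM].
  have [Mz|Mp] := eqVneq M 0.
    move: xM yM; rewrite /C Mz mulr0 mul0r !normr_le0 => /eqP -> /eqP ->.
    by rewrite subrr.
  move: x1 x2 y1 y2.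
  set X := (x ord0 i + M) / (2 * M); set Y := (y ord0 i + M) / (2 * M).
  have -> : x ord0 i - y ord0 i = (X - Y) * C by rewrite /X /Y /C; field.
  have -> : a.+1%:R / N%:R = a%:R / N%:R + N%:R^-1 :> R.
    by rewrite -[a.+1]addn1 natrD mulrDl mul1r.
  move=> x1 x2 y1 y2; rewrite normrM (ger0_norm C0) mulrC ler_wpM2l //.
  by rewrite ler_norml; lra.
- move=> x /= xM; have xi i : `|x ord0 i| <= M := le_trans (row_coord_le x i) xM.
  have ex i : exists2 a, (a < N)%N & cell a (x ord0 i).
    (* For [M = 0] the box is a point and the quotient in [cell] is 0, division by zero being
       zero. *)
    have [Mz|Mp] := eqVneq M 0.
      exists 0%N => //; split => //=; rewrite Mz mulr0 invr0 mulr0 mul0r lexx /=.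
      by rewrite divr_ge0.
    have Mp' : 0 < 2 * M by rewrite mulr_gt0 // lt_def Mp.
    have [||a aN ha] := @grid_cell ((x ord0 i + M) / (2 * M)) N N0.
    + by rewrite divr_ge0 ?(ltW Mp') //; have := xi i; rewrite ler_norml; lra.
    + by rewrite ler_pdivrMr // mul1r; have := xi i; rewrite ler_norml; lra.
    by exists a.
  have [a aN ha] := ex ord0; have [b bN hb] := ex (Ordinal (isT : (1 < 2)%N)).
  exists (a * N + b)%N => //.
  have kN : (a * N + b < N * N)%N.
    by apply: (@leq_trans (a * N + N)); rewrite ?ltn_add2l // -mulSnr leq_mul2r aN orbT.
  rewrite /F kN /= => i; rewrite divnMDl // divn_small // addn0 modnMDl modn_small //.
  case: eqP => [-> //|i0].
  suff -> : i = Ordinal (isT : (1 < 2)%N) by [].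
  by apply: val_inj; case: i i0 => [[|[|]]] //= h i0; exfalso; apply: i0; apply: val_inj.
- move=> K; have -> : \sum_(0 <= k < K) (if (k < N * N)%N then C / N%:R else 0) ^+ 3 =
      \sum_(0 <= k < K) (if (k < N * N)%N then (C / N%:R) ^+ 3 else 0).
    by apply: eq_bigr => k _; case: ifP => // _; rewrite expr0n.
  apply: le_trans (sum_const_bounded _ _ _) _.
    by apply: exprn_ge0; apply: divr_ge0 => //; exact: ltW.
  have -> : (N * N)%:R * (C / N%:R) ^+ 3 = C ^+ 3 / N%:R.
    by rewrite natrM; field; rewrite gt_eqF.
  by rewrite ler_pdivrMr.
Qed.

Lemma hnull_plane : hnull 3 [set: 'rV[R]_2].
Proof.
apply: (@hnull_sub _ _ _ (\bigcup_j box j%:R)).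
  move=> x _; exists (Num.truncn `|x|).+1 => //=.
  by apply: ltW; exact: truncnS_gt.
by apply: hnull_bigcup => // j; exact: hnull_box.
Qed.

End Hnull.

(** * Locally Lipschitz images of null sets *)

Section Lipschitz.
Context {R : realType} {n : nat}.
Implicit Types (K : nat -> set 'rV[R]_n.+1) (f g : 'rV[R]_n.+1 -> R).

(** The constants may depend on the piece [K j] of an exhaustion. Boundedness is included so that
    products stay in the class. *)
Definition lip_on K f := forall j, exists2 L, 0 <= L &
  (forall x, K j x -> `|f x| <= L) /\
  (forall x y, K j x -> K j y -> `|f x - f y| <= L * `|x - y|).

Lemma lip_cst K a : lip_on K (fun=> a).
Proof.
move=> j; exists `|a| => //; split=> // x y _ _.
by rewrite subrr normr0 mulr_ge0.
Qed.

Lemma lip_add K f g : lip_on K f -> lip_on K g -> lip_on K (fun x => f x + g x).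
Proof.
move=> fL gL j; have [L L0 [fb fl]] := fL j; have [M M0 [gb gl]] := gL j.
exists (L + M); first exact: addr_ge0.
split=> [x Kx|x y Kx Ky].
  by apply: (le_trans (ler_normD _ _)); rewrite lerD ?fb ?gb.
have -> : f x + g x - (f y + g y) = (f x - f y) + (g x - g y) by ring.
by apply: (le_trans (ler_normD _ _)); rewrite mulrDl lerD ?fl ?gl.
Qed.

Lemma lip_mul K f g : lip_on K f -> lip_on K g -> lip_on K (fun x => f x * g x).
Proof.
move=> fL gL j; have [L L0 [fb fl]] := fL j; have [M M0 [gb gl]] := gL j.
have LM : 0 <= L * M by exact: mulr_ge0.
exists (2 * (L * M)); first exact: mulr_ge0.
split=> [x Kx|x y Kx Ky].
  have : `|f x * g x| <= L * M by rewrite normrM ler_pM ?fb ?gb.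
  lra.
have -> : f x * g x - f y * g y = f x * (g x - g y) + g y * (f x - f y) by ring.
apply: (le_trans (ler_normD _ _)); rewrite !normrM.
have h1 : `|f x| * `|g x - g y| <= L * (M * `|x - y|) by rewrite ler_pM ?fb ?gl.
have h2 : `|g y| * `|f x - f y| <= M * (L * `|x - y|) by rewrite ler_pM ?gb ?fl.
lra.
Qed.

Lemma lip_opp K f : lip_on K f -> lip_on K (fun x => - f x).
Proof.
move=> fL j; have [L L0 [fb fl]] := fL j; exists L => //; split=> [x Kx|x y Kx Ky].
  by rewrite normrN fb.
by rewrite -opprD normrN fl.
Qed.

(** The difference of two roots is the difference of the arguments divided by the sum of the roots,
    which is bounded below on each piece. *)
Lemma lip_sqrt K f : (forall j, exists2 d, 0 < d & forall x, K j x -> d <= f x) ->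
  lip_on K f -> lip_on K (fun x => Num.sqrt (f x)).
Proof.
move=> fd fL j; have [L L0 [fb fl]] := fL j; have [d d0 dP] := fd j.
have s0 : 0 < Num.sqrt d by rewrite sqrtr_gt0.
exists (1 + L + L / Num.sqrt d).
  by rewrite !addr_ge0 // divr_ge0 // ltW.
have Ld : 0 <= L / Num.sqrt d by rewrite divr_ge0 // ltW.
split=> [x Kx|x y Kx Ky].
  have fx : 0 <= f x by apply: le_trans (dP _ Kx); exact: ltW.
  rewrite ger0_norm ?sqrtr_ge0 //.
  have := fb _ Kx; rewrite ger0_norm // -{1}(sqr_sqrtr fx).
  by have := sqrtr_ge0 (f x); move: (Num.sqrt (f x)) => w w0; have := sqr_ge0 (w - 1); nra.
have fx : 0 <= f x by apply: le_trans (dP _ Kx); exact: ltW.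
have fy : 0 <= f y by apply: le_trans (dP _ Ky); exact: ltW.
have := fl _ _ Kx Ky; rewrite -{1}(sqr_sqrtr fx) -{1}(sqr_sqrtr fy) subr_sqr normrM.
have sx : Num.sqrt d <= Num.sqrt (f x) by rewrite ler_wsqrtr // dP.
have sy : 0 <= Num.sqrt (f y) by exact: sqrtr_ge0.
rewrite (ger0_norm (_ : 0 <= Num.sqrt (f x) + Num.sqrt (f y))); last by lra.
move: (normr_ge0 (Num.sqrt (f x) - Num.sqrt (f y))) => D0 hD.
have h : `|Num.sqrt (f x) - Num.sqrt (f y)| <= L / Num.sqrt d * `|x - y|.
  rewrite mulrAC ler_pdivlMr //; apply: le_trans hD.
  by rewrite ler_wpM2l //; lra.
apply: (le_trans h); rewrite ler_wpM2r //; lra.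
Qed.

Lemma lip_coord K i : (forall j x, K j x -> `|x| <= j%:R) ->
  lip_on K (fun x => x ord0 i).
Proof.
move=> Kb j; exists (j%:R + 1); first by rewrite addr_ge0.
split=> [x Kx|x y _ _].
  by apply: (le_trans (row_coord_le x i)); have := Kb _ _ Kx; lra.
have := row_coord_le (x - y) i; rewrite !mxE => h; apply: (le_trans h).
by rewrite ler_peMl // lerDr.
Qed.

Lemma hnull_lip_image d n' K (A : set 'rV[R]_n.+1) (f : 'rV[R]_n.+1 -> 'rV[R]_n'.+1) :
  (0 < d)%N -> A `<=` \bigcup_j K j ->
  (forall i, lip_on K (fun x => f x ord0 i)) -> hnull d A -> hnull d (f @` A).
Proof.
move=> d0 AK fL A0; apply: (@hnull_sub _ _ _ _ (\bigcup_j (f @` (A `&` K j)))).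
  by move=> _ [x Ax <-]; have [j _ Kx] := AK _ Ax; exists j => //; exists x.
apply: hnull_bigcup => // j.
have fL' i : exists L, 0 <= L /\
    forall x y, K j x -> K j y -> `|f x ord0 i - f y ord0 i| <= L * `|x - y|.
  by have [L L0 [_ fl]] := fL i j; exists L.
have [L LP] := choice fL'.
have L0 i : 0 <= L i by case: (LP i).
apply: (@hnull_lipschitz _ _ _ _ _ _ (\sum_i L i)); first exact: sumr_ge0.
  move=> x y [_ Kx] [_ Ky]; apply: row_norm_le; first by rewrite mulr_ge0 // sumr_ge0.
  move=> i; rewrite !mxE; have [_ fl] := LP i; apply: (le_trans (fl _ _ Kx Ky)).
  by rewrite ler_wpM2r // (bigD1 i) //= lerDl sumr_ge0.
by apply: hnull_sub A0 => x [].
Qed.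

End Lipschitz.

(** * The chart in explicit coordinates *)

Definition row4 (R : realType) (x0 x1 x2 x3 : R) : 'rV[R]_4 :=
  \row_(j < 4) [:: x0; x1; x2; x3]`_j.

Definition i0 : 'I_4 := @Ordinal 4 0 isT.
Definition i1 : 'I_4 := @Ordinal 4 1 isT.
Definition i2 : 'I_4 := @Ordinal 4 2 isT.
Definition i3 : 'I_4 := @Ordinal 4 3 isT.

Lemma ord4P (P : 'I_4 -> Prop) : P i0 -> P i1 -> P i2 -> P i3 -> forall i, P i.
Proof.
move=> P0 P1 P2 P3 [[|[|[|[|//]]]] hi].
- by rewrite (_ : Ordinal hi = i0) //; apply: val_inj.
- by rewrite (_ : Ordinal hi = i1) //; apply: val_inj.
- by rewrite (_ : Ordinal hi = i2) //; apply: val_inj.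
- by rewrite (_ : Ordinal hi = i3) //; apply: val_inj.
Qed.

Lemma row4E (R : realType) (a b c d : R) :
  [/\ row4 a b c d ord0 i0 = a, row4 a b c d ord0 i1 = b,
      row4 a b c d ord0 i2 = c & row4 a b c d ord0 i3 = d].
Proof. by rewrite /row4 !mxE. Qed.

Lemma row4_ext (R : realType) (x y : 'rV[R]_4) : x ord0 i0 = y ord0 i0 ->
  x ord0 i1 = y ord0 i1 -> x ord0 i2 = y ord0 i2 -> x ord0 i3 = y ord0 i3 -> x = y.
Proof.
by move=> h0 h1 h2 h3; apply/matrixP => i j; rewrite (ord1 i); move: j; apply: ord4P.
Qed.

Lemma hnull_row4 (R : realType) n d (K : nat -> set 'rV[R]_n.+1) (A : set 'rV[R]_n.+1)
    (f0 f1 f2 f3 : 'rV[R]_n.+1 -> R) : (0 < d)%N -> A `<=` \bigcup_j K j ->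
  lip_on K f0 -> lip_on K f1 -> lip_on K f2 -> lip_on K f3 -> hnull d A ->
  hnull d [set row4 (f0 x) (f1 x) (f2 x) (f3 x) | x in A].
Proof.
move=> d0 AK l0 l1 l2 l3; apply: hnull_lip_image d0 AK _.
have e (f g : 'rV[R]_n.+1 -> R) : (forall x, f x = g x) -> lip_on K g -> lip_on K f.
  by move=> /funext ->.
by apply: ord4P; [apply: e l0|apply: e l1|apply: e l2|apply: e l3] => x; rewrite mxE.
Qed.

Section Chart.
Context {R : realType}.
Variables (m : 'I_3 -> R) (c : R).
Hypothesis m_gt0 : forall i, 0 < m i.

Let M := m b1 + m b2 + m b3.
Let M_gt0 : 0 < M. Proof. by rewrite !addr_gt0. Qed.
Let h (x : phase R) i := henergy (m i) (vel m x i) (pos x i).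

Lemma chartE x : chart m x = row4 (h x b1 - m b1 / M * H m x)
  (h x b1 + h x b2 - (m b1 + m b2) / M * H m x)
  (vel m x b1 - vel m x b2) (vel m x b2 - vel m x b3).
Proof.
pose u : 'cV[R]_3 := col3 (H m x) (h x b1 - m b1 / M * H m x)
  (h x b1 + h x b2 - (m b1 + m b2) / M * H m x).
have sum_mx (B : 'M[R]_3) (w : 'cV[R]_3) i : (B *m w) i ord0 =
    B i b1 * w b1 ord0 + B i b2 * w b2 ord0 + B i b3 * w b3 ord0.
  by rewrite mxE sum3E.
have M0 : M != 0 by rewrite gt_eqF.
have hu : \col_(i < 3) energy m x i = Amx m *m u.
  apply/matrixP => i j; rewrite (ord1 j) sum_mx mxE (energyE' m_gt0) /u !col3E.
  rewrite (HE m_gt0 x) -/(h x b1) -/(h x b2) -/(h x b3) -/(h x i).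
  move: (h x) => g; move: i; apply: ord3P; rewrite !mxE /= /M; by field.
(* [B] is the inverse of [Amx m], so that [invmx] in [xi] is a genuine inverse. *)
pose B : 'M[R]_3 := \matrix_(i < 3, j < 3)
  [:: 1; [:: 1 - m b1 / M; - (m b1 / M); - (m b1 / M)]`_j;
         [:: m b3 / M; m b3 / M; m b3 / M - 1]`_j]`_i.
have Au : Amx m \in unitmx.
  suff /mulmx1_unit[] : B *m Amx m = 1%:M by [].
  apply/matrixP => i j; rewrite !mxE sum3E !mxE.
  by move: i; apply: ord3P; move: j; apply: ord3P; rewrite /= ?mxE /= /M; field.
have xiE : xi m x = u by rewrite /xi hu mulmxA mulVmx // mul1mx.
have etaE i : Defs.eta m x i ord0 = \sum_(j < 3) Amx m j i * vel m x j.
  by rewrite /Defs.eta mxE; apply: eq_bigr => j _; rewrite !mxE.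
by apply: row4_ext; rewrite {1}/chart /row4 [LHS]mxE [RHS]mxE /=;
  [rewrite xiE col3E|rewrite xiE col3E|rewrite etaE sum3E !mxE /=; ring
  |rewrite etaE sum3E !mxE /=; ring].
Qed.

End Chart.

Lemma hnullU (R : realType) n d (A B : set 'rV[R]_n.+1) : (0 < d)%N ->
  hnull d A -> hnull d B -> hnull d (A `|` B).
Proof.
move=> d0 A0 B0; apply: (@hnull_sub _ _ _ _ (\bigcup_j (if j is 0%N then A else B))).
  by move=> x [Ax|Bx]; [exists 0%N|exists 1%N].
by apply: hnull_bigcup => // -[|j].
Qed.

Ltac lip := repeat first [apply: lip_cst | apply: lip_coord | apply: lip_add
  | apply: lip_opp | apply: lip_mul].

(** * Collisions and tangential contacts in the chart *)

Section ChartDynamics.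
Context {R : realType}.
Variables (m : 'I_3 -> R) (c : R).
Hypothesis m_gt0 : forall i, 0 < m i.

Let M := m b1 + m b2 + m b3.
Let C1 := m b1 / M * c.
Let C2 := (m b1 + m b2) / M * c.
Let p := 1 + gamma m b1 b2.
Let r := 1 - gamma m b2 b3.
(** Half the coefficient in [alpha], as the differential of k_1 (eta_2)^2 is the shear alpha_1 delta
    eta_2; likewise for [k2] and eta_3. *)
Let k1 := m b1 * m b2 * (m b1 - m b2) / (m b1 + m b2) ^+ 2.
Let k2 := m b2 * m b3 * (m b2 - m b3) / (m b2 + m b3) ^+ 2.

Let m1_neq0 : m b1 != 0. Proof. by rewrite gt_eqF. Qed.
Let m12_neq0 : m b1 + m b2 != 0. Proof. by rewrite gt_eqF // addr_gt0. Qed.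
Let m23_neq0 : m b2 + m b3 != 0. Proof. by rewrite gt_eqF // addr_gt0. Qed.
Let M_neq0 : M != 0. Proof. by rewrite gt_eqF // !addr_gt0. Qed.

(* The collision maps in the chart.  Only at the floor does one have to know
   whether the state is before (s = 1) or after (s = -1) the collision. *)
Definition chart_collision (s : R) (k : wall) (y : 'rV[R]_4) : 'rV[R]_4 :=
  let a i := y ord0 i in
  match k with
  | Floor => row4 (a i0) (a i1)
      (a i2 + s * (2 * Num.sqrt ((a i0 + C1) * (2 / m b1)))) (a i3)
  | Balls12 => row4 (- a i0 + p * a i1 + - (k1 * (a i2 * a i2))) (a i1)
      (- a i2) (p * a i2 + a i3)
  | Balls23 => row4 (a i0) (r * a i0 + - a i1 + - (k2 * (a i3 * a i3)))
      (a i2 + r * a i3) (- a i3)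
  end.

(** The sum is the energy of ball 1, positive at the floor exactly if its velocity is nonzero; the
    square root is locally Lipschitz there. *)
Definition chart_domain (k : wall) : set 'rV[R]_4 :=
  [set y | k = Floor -> 0 < y ord0 i0 + C1].

Lemma chart_flow t (x : phase R) : chart m (flow m t x) = chart m x.
Proof.
rewrite !chartE // !henergy_flow // H_flow // !vel_flow //.
by congr row4; ring.
Qed.

Lemma chart_Phi s k (x : phase R) : H m x = c -> gap k x = 0 ->
  (k = Floor -> s * `|vel m x b1| = - vel m x b1) ->
  chart m (Phi m k x) = chart_collision s k (chart m x).
Proof.
move=> Hx gx sx; rewrite /chart_collision; have [e0 e1 e2 e3] := row4E
  (henergy (m b1) (vel m x b1) (pos x b1) - m b1 / M * H m x)
  (henergy (m b1) (vel m x b1) (pos x b1) + henergy (m b2) (vel m x b2) (pos x b2)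
    - (m b1 + m b2) / M * H m x)
  (vel m x b1 - vel m x b2) (vel m x b2 - vel m x b3).
rewrite !chartE // e0 e1 e2 e3 {e0 e1 e2 e3} H_Phi // !pos_Phi !vel_Phi // Hx.
case: k gx sx; rewrite /gap /velPhi /henergy => gx sx; rewrite !col3E.
- have -> : (m b1 * vel m x b1 ^+ 2 / 2 + m b1 * pos x b1 - m b1 / M * c + C1) * (2 / m b1)
    = vel m x b1 ^+ 2.
    by rewrite gx /C1; field; rewrite ?M_neq0 ?m1_neq0.
  rewrite sqrtr_sqr; congr row4; rewrite ?sqrrN //.
  by rewrite mulrCA sx //; ring.
- have q2 : pos x b2 = pos x b1 by apply/eqP; rewrite -subr_eq0 gx.
  by rewrite q2; congr row4; rewrite /k1 /p /gamma /M; field; rewrite ?m12_neq0 ?M_neq0.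
- have q3 : pos x b3 = pos x b2 by apply/eqP; rewrite -subr_eq0 gx.
  have ce := Hx; rewrite (HE m_gt0) q3 /henergy in ce.
  by congr row4; rewrite -?ce /k2 /r /gamma /M; field; rewrite ?m23_neq0 ?M_neq0.
Qed.

(** An exhaustion of [chart_domain k] by bounded sets on which the energy of ball 1 is bounded below
    if [k] is the floor. *)
Let K (k : wall) j : set 'rV[R]_4 := [set y : 'rV[R]_4 | `|y| <= j%:R /\
  (k = Floor -> j.+1%:R^-1 <= y ord0 i0 + C1)].

Let K_le k j (y : 'rV[R]_4) : K k j y -> `|y| <= j%:R. Proof. by case. Qed.

Let K_cover k : chart_domain k `<=` \bigcup_j K k j.
Proof.
move=> y yD; pose a := `|y| + `|(y ord0 i0 + C1)^-1|.
exists (Num.truncn a).+1 => //.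
have ha : a < (Num.truncn a).+1%:R := truncnS_gt _.
have n1 := normr_ge0 y; have n2 := normr_ge0 (y ord0 i0 + C1)^-1.
split; first by apply: ltW; apply: le_lt_trans ha; rewrite /a lerDl.
move=> /yD y0; rewrite -[leRHS]invrK lef_pV2 ?posrE ?invr_gt0 //.
apply: le_trans (ler_norm _) _; apply: (@le_trans _ _ a); first by rewrite /a lerDr.
by apply: (le_trans (ltW ha)); rewrite ler_nat.
Qed.

Let lip_collision s k (A : set 'rV[R]_4) : A `<=` chart_domain k -> hnull 3 A ->
  hnull 3 (chart_collision s k @` A).
Proof.
move=> AD A0; have AK : A `<=` \bigcup_j K k j := subset_trans AD (K_cover (k := k)).
case: k AD AK => AD AK; rewrite /chart_collision.
- apply: (hnull_row4 (K := K Floor)) => //; lip; try exact: K_le.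
  apply: lip_sqrt; last by lip; exact: K_le.
  move=> j; exists (j.+1%:R^-1 * (2 / m b1)).
    by rewrite mulr_gt0 ?invr_gt0 // divr_gt0.
  by move=> y [_ /(_ erefl) hy]; rewrite ler_pM2r // divr_gt0.
- by apply: (hnull_row4 (K := K Balls12)) => //; lip; exact: K_le.
- by apply: (hnull_row4 (K := K Balls23)) => //; lip; exact: K_le.
Qed.

Definition tangential_chart : set 'rV[R]_4 :=
  [set chart m x | x in [set x | Dom m c x /\ tangential m x]].

(** Contains the chart points from which a branch of [n] steps leads to a tangential contact, a
    forward branch for s = -1 and a backward one for s = 1. Collisions being involutions, both are
    obtained as images under [chart_collision]. *)
Fixpoint tangential_preimage (s : R) (n : nat) : set 'rV[R]_4 :=
  if n is n'.+1 then
    let im k := chart_collision s k @` (tangential_preimage s n' `&` chart_domain k) in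
    im Floor `|` (im Balls12 `|` im Balls23)
  else tangential_chart.

(** A tangential contact leaves two free parameters, so these points lie on four surfaces that are
    polynomial images of the plane. *)
Lemma hnull_tangential_chart : hnull 3 tangential_chart.
Proof.
pose B j : set 'rV[R]_2 := [set x | `|x| <= j%:R].
have Bb j x : B j x -> `|x| <= j%:R by [].
have Bc : [set: 'rV[R]_2] `<=` \bigcup_j B j.
  by move=> x _; exists (Num.truncn `|x|).+1 => //; apply: ltW; exact: truncnS_gt.
pose j0 : 'I_2 := ord0; pose j1 : 'I_2 := Ordinal (isT : (1 < 2)%N).
pose surf (f0 f1 f2 f3 : 'rV[R]_2 -> R) :=
  [set row4 (f0 y) (f1 y) (f2 y) (f3 y) | y in [set: 'rV[R]_2]].
have sn f0 f1 f2 f3 : lip_on B f0 -> lip_on B f1 -> lip_on B f2 -> lip_on B f3 ->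
    hnull 3 (surf f0 f1 f2 f3).
  by move=> *; apply: (hnull_row4 (K := B)) => //; exact: hnull_plane.
have row2 (u v : R) : exists y : 'rV[R]_2, y ord0 j0 = u /\ y ord0 j1 = v.
  by exists (\row_(j < 2) [:: u; v]`_j); rewrite !mxE.
have in_surf (f0 f1 f2 f3 : 'rV[R]_2 -> R) (u v : R) (z : 'rV[R]_4) :
    (forall y : 'rV[R]_2, y ord0 j0 = u -> y ord0 j1 = v -> z = row4 (f0 y) (f1 y) (f2 y) (f3 y)) ->
    surf f0 f1 f2 f3 z.
  by move=> h; have [y [yu yv]] := row2 u v; exists y => //; rewrite (h y yu yv).
(* The surfaces stand for a tangential contact 12, one of 23, and ball 1 at rest on the floor with a
   contact 12 or 23. In the second and fourth, conservation of energy determines the remaining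
   coordinate. *)
apply: (@hnull_sub _ _ _ _ (
  surf (fun y => y ord0 j0) (fun y => y ord0 j0 * ((m b1 + m b2) / m b1))
       (fun=> 0) (fun y => y ord0 j1) `|`
 (surf (fun y => y ord0 j0)
       (fun y => y ord0 j0 + C1 + m b2 / (m b2 + m b3) * (c + - (y ord0 j0 + C1)) + - C2)
       (fun y => y ord0 j1) (fun=> 0) `|`
 (surf (fun=> - C1) (fun y => m b2 / 2 * (y ord0 j0 * y ord0 j0) + - C2)
       (fun y => y ord0 j0) (fun y => y ord0 j1) `|`
  surf (fun=> - C1)
       (fun y => m b2 * (2^-1 * (y ord0 j0 * y ord0 j0) +
          (m b2 + m b3)^-1 * (c + - (m b2 / 2 * (y ord0 j0 * y ord0 j0)) +
            - (m b3 / 2 * ((y ord0 j0 + y ord0 j1) * (y ord0 j0 + y ord0 j1))))) + - C2)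
       (fun y => y ord0 j0) (fun y => y ord0 j1))))); last first.
  by do ![apply: hnullU => //]; apply: sn; lip; exact: Bb.
move=> _ [x [[Hx _] Tx] <-].
have ce := Hx; rewrite (HE m_gt0) /henergy in ce.
rewrite chartE // Hx /henergy; case: Tx; rewrite /gap /rvel.
- move=> [gq gv]; left; apply: (in_surf _ _ _ _
    (m b1 * vel m x b1 ^+ 2 / 2 + m b1 * pos x b1 - C1) (vel m x b2 - vel m x b3)).
  move=> y -> ->.
  have q2 : pos x b2 = pos x b1 by apply/eqP; rewrite -subr_eq0 gq.
  have v2 : vel m x b2 = vel m x b1 by apply/esym/eqP; rewrite -subr_eq0 gv.
  by congr row4; rewrite ?q2 ?v2 /C1 /M; field; rewrite ?m1_neq0 ?M_neq0.
- move=> [gq gv]; right; left; apply: (in_surf _ _ _ _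
    (m b1 * vel m x b1 ^+ 2 / 2 + m b1 * pos x b1 - C1) (vel m x b1 - vel m x b2)).
  move=> y -> ->.
  have q3 : pos x b3 = pos x b2 by apply/eqP; rewrite -subr_eq0 gq.
  have v3 : vel m x b3 = vel m x b2 by apply/esym/eqP; rewrite -subr_eq0 gv.
  rewrite q3 v3 in ce *.
  by congr row4; rewrite /C1 /C2 /M -?ce; field; rewrite ?m23_neq0 ?M_neq0.
- move=> [q1 v1 hor]; right; right.
  have {}v1 : vel m x b1 = 0 by apply/eqP; rewrite -oppr_eq0 v1.
  case: hor => gq; [left|right]; apply: (in_surf _ _ _ _
    (vel m x b1 - vel m x b2) (vel m x b2 - vel m x b3)) => y -> ->.
    have q2 : pos x b2 = pos x b1 by apply/eqP; rewrite -subr_eq0 gq.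
    by congr row4; rewrite ?q2 ?q1 ?v1 /C1 /C2 /M; field; rewrite ?M_neq0.
  have q3 : pos x b3 = pos x b2 by apply/eqP; rewrite -subr_eq0 gq.
  rewrite q3 q1 v1 in ce *.
  by congr row4; rewrite /C1 /C2 /M -?ce; field; rewrite ?m23_neq0 ?M_neq0.
Qed.

Lemma hnull_tangential_preimage s n : hnull 3 (tangential_preimage s n).
Proof.
elim: n => [|n IH] /=; first exact: hnull_tangential_chart.
have im k : hnull 3 (chart_collision s k @` (tangential_preimage s n `&` chart_domain k)).
  by apply: lip_collision; [exact: subIsetr|apply: hnull_sub IH; exact: subIsetl].
by do ![apply: hnullU => //].
Qed.

Lemma step_Dom k (x y : phase R) : step m c k x y -> Dom m c y.
Proof. by case=> _ /MmP[D _ _] ->; exact: Dom_Phi. Qed.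

Lemma tangential_preimageS s n k y :
  tangential_preimage s n y -> chart_domain k y ->
  tangential_preimage s n.+1 (chart_collision s k y).
Proof.
move=> yn yk /=; case: k yk => yk; [left|right; left|right; right]; exists y => //.
Qed.

Lemma chart_domainE (x : phase R) k : H m x = c -> gap k x = 0 ->
  (k = Floor -> vel m x b1 != 0) -> chart_domain k (chart m x).
Proof.
move=> Hx gx vx kF; have [e0 _ _ _] := row4E
  (henergy (m b1) (vel m x b1) (pos x b1) - m b1 / M * H m x)
  (henergy (m b1) (vel m x b1) (pos x b1) + henergy (m b2) (vel m x b2) (pos x b2)
    - (m b1 + m b2) / M * H m x)
  (vel m x b1 - vel m x b2) (vel m x b2 - vel m x b3).
rewrite chartE // e0 Hx /henergy; move: gx; rewrite kF /gap => ->.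
have -> : m b1 * vel m x b1 ^+ 2 / 2 + m b1 * 0 - m b1 / M * c + C1 =
    m b1 * vel m x b1 ^+ 2 / 2 by rewrite /C1; ring.
by rewrite divr_gt0 // mulr_gt0 // lt_def sqr_ge0 andbT sqrf_eq0 vx.
Qed.

(** Induction along the branch: its first step is undone by one collision map, since the chart is
    constant along the flow. *)
Lemma fbranch_tangential n x s k : Dom m c x -> fbranch m c n x s k ->
  tangential m (s n) -> tangential_preimage (-1) n (chart m x).
Proof.
elim: n x s k => [|n IH] x s k Dx [s0 st] Ts.
  by exists (s 0%N); rewrite ?s0 //; split => //; rewrite -s0.
have st0 := st 0%N isT; have D1 := step_Dom st0.
have hn : tangential_preimage (-1) n (chart m (s 1%N)).
  apply: (IH (s 1%N) (fun i => s i.+1) (fun i => k i.+1)) => //.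
  by split => // i ni; exact: st.
case: st0 => _ hm e1; rewrite s0 in hm e1; have [H1 _] := D1.
have /MmP[_ g0 v0] := hm.
have hz : hit m c x = Phi m (k 0%N) (s 1%N) by rewrite e1 PhiK.
have g1 : gap (k 0%N) (s 1%N) = 0 by rewrite e1.
have v1 : k 0%N = Floor -> 0 < vel m (s 1%N) b1.
  by move=> kF; move: v0; rewrite e1 kF vel_Phi // /velPhi col3E.
have -> : chart m x = chart m (hit m c x) by rewrite /hit chart_flow.
rewrite hz (@chart_Phi (-1)) //.
  apply: tangential_preimageS => //; apply: chart_domainE => // /v1.
  by move=> h; rewrite gt_eqF.
by move=> /v1 h; rewrite gtr0_norm // mulN1r.
Qed.

Lemma bbranch_tangential n x s k : Dom m c x -> bbranch m c n x s k ->
  tangential m (s n) -> tangential_preimage 1 n (chart m x).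
Proof.
elim: n x s k => [|n IH] x s k Dx [s0 st] Ts.
  by exists (s 0%N); rewrite ?s0 //; split => //; rewrite -s0.
have st0 := st 0%N isT.
have D1 : Dom m c (s 1%N) by case: st0 => -[l /MpP[]].
have hn : tangential_preimage 1 n (chart m (s 1%N)).
  apply: (IH (s 1%N) (fun i => s i.+1) (fun i => k i.+1)) => //.
  by split => // i ni; exact: st.
case: st0 => _ /MmP[[H1 _] g0 v0] e1; rewrite s0 in e1.
have v1 : k 0%N = Floor -> vel m (hit m c (s 1%N)) b1 < 0.
  by move=> kF; move: v0; rewrite kF /rvel oppr_gt0.
have ce : chart m (hit m c (s 1%N)) = chart m (s 1%N) by rewrite chart_flow.
rewrite e1 (@chart_Phi 1) //; last by move=> /v1 h; rewrite ltr0_norm // mul1r.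
rewrite -ce in hn; apply: tangential_preimageS => //; apply: chart_domainE => // /v1.
by move=> h; rewrite lt_eqF.
Qed.

End ChartDynamics.

(** * Closures of the two cones *)

Section Closure.
Context {R : realType}.

Lemma closure_preimage (T : topologicalType) (A : set T) (f : T -> R) (F : set R) w :
  continuous f -> closed F -> (forall x, A x -> F (f x)) -> closure A w -> F (f w).
Proof.
move=> fc Fcl AF Aw; apply: contrapT => nF.
have [x [Ax]] := Aw _ (fc w _ (open_nbhs_nbhs (conj (closed_openC Fcl) nF))).
by apply; exact: AF.
Qed.

Let coord1 i : continuous (fun w : tvec R => w.1 i ord0).
Proof.
move=> w; apply: (@continuous_comp _ _ _ (@fst 'cV[R]_3 'cV[R]_3) (fun M : 'cV[R]_3 => M i ord0)).
  exact: cvg_fst.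
exact: coord_continuous.
Qed.

Let coord2 i : continuous (fun w : tvec R => w.2 i ord0).
Proof.
move=> w; apply: (@continuous_comp _ _ _ (@snd 'cV[R]_3 'cV[R]_3) (fun M : 'cV[R]_3 => M i ord0)).
  exact: cvg_snd.
exact: coord_continuous.
Qed.

Lemma Q_continuous : continuous (@Q R).
Proof.
have -> : @Q R = (fun w => w.1 b1 ord0 * w.2 b1 ord0 + w.1 b2 ord0 * w.2 b2 ord0
    + w.1 b3 ord0 * w.2 b3 ord0) by apply/funext => w; rewrite /Q sum3E.
move=> w; apply: cvgD; first apply: cvgD;
  by apply: cvgM; [exact: coord1|exact: coord2].
Qed.

Lemma closure_L12 (A : set (tvec R)) w : A `<=` @L12 R -> closure A w -> L12 w.
Proof.
move=> AL Aw; split.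
  by apply: (closure_preimage (coord1 (i := b1)) (@closed_eq R 0) _ Aw) => x /AL[].
by apply: (closure_preimage (coord2 (i := b1)) (@closed_eq R 0) _ Aw) => x /AL[].
Qed.

Let L12_0 : L12 (0 : tvec R). Proof. by split; rewrite mxE. Qed.
Let Q0 : Q (0 : tvec R) = 0. Proof. by rewrite /Q sum3E !mxE; ring. Qed.

Lemma closure_cone w : closure (@cone R) w -> L12 w /\ 0 <= Q w.
Proof.
move=> cw; split; first by apply: closure_L12 cw => x [[]|->].
by apply: (closure_preimage Q_continuous (@closed_ge R 0) _ cw) => x [[_ /ltW]|->] //=; rewrite Q0.
Qed.

Lemma closure_cone' w : closure (@cone' R) w -> L12 w /\ Q w <= 0.
Proof.
move=> cw; split; first by apply: closure_L12 cw => x [[]|->].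
by apply: (closure_preimage Q_continuous (@closed_le R 0) _ cw) => x [[_ /ltW]|->] //=; rewrite Q0.
Qed.

End Closure.

(** * Divergence along infinite branches and the exceptional null set *)

Section Expansion.
Context {R : realType}.
Variables (m : 'I_3 -> R) (c : R).
Hypotheses (h12 : m b2 < m b1) (h23 : m b3 <= m b2) (h3 : 0 < m b3).
Hypothesis hm : 2 * Num.sqrt (m b1) * Num.sqrt (m b3) =
  Num.sqrt (m b1 + m b2) * Num.sqrt (m b2 + m b3).
Hypothesis hc : 0 < c.
Let m_gt0 := mass_gt0 h12 h23 h3.

Lemma Q_forward x s k w : (forall n, fbranch m c n x s k) ->
  closure (@cone R) w -> w <> 0 -> Q (dTn m c s k n w) @[n --> \oo] --> +oo.
Proof.
move=> b /closure_cone[wL Qw] w0; apply/cvgryPge => A.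
have [N NP] := Q_diverges h12 h23 h3 hm hc (fbranch_orbit b)
  (w := fun n => dTn m c s k n w) (fun=> erefl) wL Qw w0 A.
by exists N.
Qed.

Lemma Q_backward x s k w : (forall n, bbranch m c n x s k) ->
  closure (@cone' R) w -> w <> 0 -> Q (dTVn m c s k n w) @[n --> \oo] --> -oo.
Proof.
move=> b /closure_cone'[[w1 w2] Qw] w0; apply/cvgrNyPle => A.
have [||| N NP] := Q_diverges h12 h23 h3 hm hc (bbranch_orbit m_gt0 b)
  (w := fun n => trev (dTVn m c s k n w)) (fun i => dTVn_trev m_gt0 w i b) _ _ _ (- A).
- by split; rewrite //= mxE w2 oppr0.
- by rewrite Q_trev oppr_ge0.
- by move=> e; apply: w0; rewrite -[w]trevK e; rewrite /trev /= oppr0.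
by exists N => // n /NP; rewrite Q_trev lerN2.
Qed.

(** Since [P] holds on all of [S], the exceptional set comes from [D] alone and lies in countably
    many null sets. *)
Lemma muS_ae_of_defined (S : set (phase R)) (D P : phase R -> Prop)
    (s : R) : (forall x, S x -> P x) ->
  (forall x, S x -> ~ D x -> exists n, tangential_preimage m c s n (chart m x)) ->
  muS_ae m S (fun x => D x /\ P x).
Proof.
move=> SP SD; apply: hnull_hausdorff => //.
apply: (@hnull_sub _ _ _ _ (\bigcup_n tangential_preimage m c s n)).
  move=> _ [x [Sx nDP] <-]; have [|n nx] := SD x Sx; last by exists n.
  by move=> Dx; apply: nDP; split => //; exact: SP.
by apply: hnull_bigcup => // n; exact: hnull_tangential_preimage.
Qed.

End Expansion.

Theorem mainTheorem2 (R : realType) (m : 'I_3 -> R) (c : R)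
    (h12 : m b2 < m b1) (h23 : m b3 <= m b2) (h3 : 0 < m b3)
    (hm : 2 * Num.sqrt (m b1) * Num.sqrt (m b3) =
          Num.sqrt (m b1 + m b2) * Num.sqrt (m b2 + m b3))
    (hc : 0 < c) :
  muS_ae m (Sminus m c) (fun x =>
    fdefined m c x /\
    forall (s : nat -> phase R) (k : nat -> wall),
      (forall n, fbranch m c n x s k) ->
      forall w : tvec R, closure (@cone R) w -> w <> 0 ->
        Q (dTn m c s k n w) @[n --> \oo] --> +oo) /\
  muS_ae m (Splus m c) (fun x =>
    bdefined m c x /\
    forall (s : nat -> phase R) (k : nat -> wall),
      (forall n, bbranch m c n x s k) ->
      forall w : tvec R, closure (@cone' R) w -> w <> 0 ->
        Q (dTVn m c s k n w) @[n --> \oo] --> -oo).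
Proof.
have m_gt0 := mass_gt0 h12 h23 h3.
split; [apply: (muS_ae_of_defined h12 h23 h3 (s := -1))|apply: (muS_ae_of_defined h12 h23 h3 (s := 1))].
- by move=> x _ s k b w; exact: Q_forward b.
- move=> x Sx /(fdefined_or_tangential m_gt0 Sx)[n [s [k [b Ts]]]].
  exists n; apply: fbranch_tangential b Ts => //.
  by case: Sx => -[[/MpP[]]].
- by move=> x _ s k b w; exact: Q_backward b.
- move=> x Sx /(bdefined_or_tangential m_gt0 Sx)[n [s [k [b Ts]]]].
  exists n; apply: bbranch_tangential b Ts => //.
  by case: Sx => -[/MpP[]].
Qed.
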